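(* Consider the two-dimensional risk model with constant interest rate described in the context (with $c_1/\delta_1>c_2/\delta_2$). For $T>0$ and $x_1,x_2$, let $$\Psi_{\max}(x_1,x_2,T)=P\{T_{\max}(\delta_1x_1,\delta_2x_2)\le T\}=P\{\exists\,t\le T:\ X_1(t)<0\text{ and }X_2(t)<0\},$$ where $X_i(t)=x_i+p_i(1-e^{-rt})-\sum_{k=1}^{N(t)}e^{-r\theta_k}\sigma_k$ and $p_i=\frac{c_i}{r\delta_i}$. Let $V$ be uniformly distributed on $(0,T]$, independent of $\sigma_1$, and $F_T(x)=P\{e^{-rV}\sigma_1\le x\}$, $\overline{F_T}=1-F_T$. Suppose $P\{\sigma_k>x\}=L(x)/x^{\alpha}$, where $\alpha>0$ and $L$ is continuous, slowly varying, with $\lim_{x\to\infty}L(x)=\infty$. Then for any $T>0$, $$\lim_{x_2\ge x_1\to\infty}\frac{\Psi_{\max}(x_1,x_2,T)}{\lambda T\,\overline{F_T}(x_2)}=1,$$ the limit being taken as $x_1\to\infty$ over pairs with $x_2\ge x_1$.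
   Context: Model: $U_i(t)=e^{rt}u_i+\frac{c_i}{r}(e^{rt}-1)-\delta_i\sum_{k=1}^{N(t)}e^{r(t-\theta_k)}\sigma_k$, $i=1,2$, where $r>0$ is the interest rate, $u_i$ initial reserves, $c_i>0$ premium rates, $0<\delta_1,\delta_2<1$ with $\delta_1+\delta_2=1$, $N(t)$ a Poisson process with intensity $\lambda>0$, $\{\sigma_k\}$ i.i.d. nonnegative claim sizes independent of $N$, and $\theta_k$ the $k$-th arrival time of $N$. $T_{\max}(u_1,u_2)=\inf\{t\ge0:\max\{U_1(t),U_2(t)\}<0\}$. Standing assumption $c_1/\delta_1>c_2/\delta_2$, i.e. $p_1>p_2$. Note $X_i(t)=e^{-rt}U_i(t)/\delta_i$ with $x_i=u_i/\delta_i$. *)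

(* Defs.v *)
From HB Require Import structures.
From mathcomp Require Import all_boot all_order all_algebra.
From mathcomp Require Import all_classical all_reals all_analysis.
Set Implicit Arguments. Unset Strict Implicit. Unset Printing Implicit Defensive.
Import Order.TTheory GRing.Theory Num.Theory.
Import numFieldNormedType.Exports.
Local Open Scope classical_set_scope.
Local Open Scope ring_scope.

Definition mutual_indep d (Omega : measurableType d) (R : realType)
  (P : probability Omega R) (I : eqType) (X : I -> Omega -> R) : Prop :=
  forall (J : seq I) (B : I -> set R), uniq J ->
    (forall j, measurable (B j)) ->
    P (\bigcap_(j in [set` J]) (X j @^-1` B j)) =
    (\prod_(j <- J) P (X j @^-1` B j))%E.

Definition slowly_varying (R : realType) (L : R -> R) : Prop :=
  (forall x, 0 < x -> 0 < L x) /\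
  forall c, 0 < c -> (fun x => L (c * x) / L x) @ +oo --> (1 : R).

(* k-th arrival time theta_k = W_0 + ... + W_{k-1} (theta_0 = 0),
   W_i being the i.i.d. exponential inter-arrival times. *)
Definition theta (Omega : Type) (R : realType) (W : nat -> Omega -> R)
  (k : nat) (w : Omega) : R := \sum_(i < k) W i w.

Definition Ncount (Omega : Type) (R : realType) (W : nat -> Omega -> R)
  (t : R) (w : Omega) (n : nat) : Prop :=
  theta W n w <= t < theta W n.+1 w.

(* X_i(t) = x + p (1 - e^{-rt}) - sum_{k=1}^{N(t)} e^{-r theta_k} sigma_k,
   evaluated with N(t) = n. *)
Definition Xproc (Omega : Type) (R : realType) (r x p : R)
  (W S : nat -> Omega -> R) (t : R) (w : Omega) (n : nat) : R :=
  x + p * (1 - expR (- r * t))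
    - \sum_(1 <= k < n.+1) expR (- r * theta W k w) * S k w.

Definition Psi_max d (Omega : measurableType d) (R : realType)
  (P : probability Omega R) (r p1 p2 : R) (W S : nat -> Omega -> R)
  (x1 x2 T : R) : R :=
  fine (P [set w | exists t, 0 <= t <= T /\ exists n, Ncount W t w n /\
            Xproc r x1 p1 W S t w n < 0 /\ Xproc r x2 p2 W S t w n < 0]).

Definition unif0T (R : realType) (T : R) (A : set R) : \bar R :=
  ((T^-1)%:E * lebesgue_measure (A `&` [set v : R | (0 < v <= T)%R]))%E.

(* F_T(x) = P{e^{-rV} sigma_1 <= x}, V ~ U(0,T] independent of sigma_1,
   realized on the product space (0,T] x Omega with product measure. *)
Definition F_T d (Omega : measurableType d) (R : realType)
  (P : probability Omega R) (r T : R) (sigma1 : Omega -> R) (x : R) : R :=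
  fine ((unif0T T \x P)%E
          [set vw : R * Omega | expR (- r * vw.1) * sigma1 vw.2 <= x]).

Definition F_T_bar d (Omega : measurableType d) (R : realType)
  (P : probability Omega R) (r T : R) (sigma1 : Omega -> R) (x : R) : R :=
  1 - F_T P r T sigma1 x.

(* Main.v *)
Require Import Defs.
From HB Require Import structures.
From mathcomp Require Import all_boot all_order all_algebra.
From mathcomp Require Import all_classical all_reals all_analysis.
From mathcomp Require Import measurable_realfun ring lra zify.
Set Implicit Arguments.
Unset Strict Implicit.
Unset Printing Implicit Defensive.
Import Order.TTheory GRing.Theory Num.Theory.
Import numFieldNormedType.Exports.
Local Open Scope classical_set_scope.
Local Open Scope ring_scope.

(** With [G] the claim tail and [J x = \int_0^T G (x e^(r v)) dv = T * F_T_bar x],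
the event of ruin lies, up to null sets and up to the bounded change [x2 + p] of
level, between the events that the discounted claim total exceeds [x2 + p] or [x2]
at some arrival before [T].  Such an excess is caused by one big discounted claim:
the density of the [k.+1]-st arrival at [x] is [lambda * P (N x = k)], so the
expected number of big claims among the first [m] is [lambda * J] up to the
factor [1 - P (theta m <= T)].  Two big claims cost [m ^ 2 * G ^ 2], by Bonferroni,
and more than [m] arrivals cost [2 ^ - m * G], because [P (theta n <= T)] decays
faster than any geometric sequence while [G (x / n) <= K ^ n * G x].  Regular
variation gives [J (c x) ~ J x] as [c --> 1] and makes all errors [o (J)]. *)

(** Only [x2] enters the limit. Ruin needs [X_2 < 0], and since premiums are nonnegative this
    already forces the discounted claims above [x2]; conversely, discounted premium income never
    exceeds [p1] or [p2], so an excess over [x2 + p] with [p] the larger of the two makes both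
    reserves negative, because [x1 <= x2]. Independence is given for finitely many single variables,
    while [theta k] mixes [k] of them; its independence of later inter-arrivals and of claims has to
    be derived first, through product measures. Discounted claims are dependent, as their arrival
    times share summands. The events with two large claims or with many arrivals are therefore
    phrased with undiscounted claims, which dominate and are independent. The number of arrivals is
    unbounded, so the constant [K] must hold at all levels and the rate in the exponential bound is
    tuned to it. The constants are fixed in the order [e], [c], [m], [delta], and the level is sent
    to infinity last: any factor depending on them is then beaten by one spare factor [G]. *)

(** * Inequalities for regularly varying tails *)

Section regular_variation.
Context {R : realType} (G L : R -> R) (alpha : R).
Hypotheses (alpha_gt0 : 0 < alpha) (L_sv : slowly_varying L).
Hypothesis GE : forall x : R, 0 < x -> G x = L x / x `^ alpha.
Hypothesis G_ninc : forall x y, x <= y -> G y <= G x.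
Hypothesis G_le1 : forall x, G x <= 1.

Lemma tail_gt0 (x : R) : 0 < x -> 0 < G x.
Proof. by move=> x0; rewrite GE// divr_gt0// ?powR_gt0//; apply: L_sv.1. Qed.

Lemma tail_ratio_cvg (c : R) : 0 < c -> G (c * x) / G x @[x --> +oo] --> c `^ (- alpha).
Proof.
move=> c0; rewrite -[c `^ _]mul1r.
apply: (@cvg_trans _ ((L (c * x) / L x * c `^ (- alpha)) @[x --> +oo])); last first.
  by apply: cvgM; [exact: L_sv.2|exact: cvg_cst].
apply: near_eq_cvg; near=> x.
have x0 : 0 < x by near: x; exact: nbhs_pinfty_gt.
rewrite !GE ?mulr_gt0// powRM ?ltW// powRN.
have Lx := L_sv.1 x x0; have px := powR_gt0 alpha x0; have pc := powR_gt0 alpha c0.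
by field; rewrite !gt_eqF.
Unshelve. all: by end_near. Qed.

Lemma tail_ratio_lt (c b : R) : 0 < c -> c `^ (- alpha) < b ->
  exists2 x0 : R, 0 < x0 & forall x, x0 <= x -> G (c * x) <= b * G x.
Proof.
move=> c0 cb; have := tail_ratio_cvg c0.
move=> /cvgrPdist_lt/(_ (b - c `^ (- alpha))); rewrite subr_gt0 => /(_ cb)[x0 [_ Hx0]].
exists (Num.max x0 1 + 1); first by rewrite ltr_wpDl// le_max ler01 orbT.
move=> x xge; have mx : Num.max x0 1 < x by rewrite (lt_le_trans _ xge)// ltrDl.
move: mx; rewrite gt_max => /andP[x0x x1].
have Gx := tail_gt0 (lt_trans ltr01 x1).
rewrite -ler_pdivrMr//; have := Hx0 _ x0x; rewrite /= distrC.
by move=> /(le_lt_trans (ler_norm _)); rewrite ltrD2r => /ltW.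
Qed.

(** Far out, regular variation gives the factor [2^alpha + 1]; up to the threshold [z] the tail lies
    between [G z] and [1], so [1 / G z] serves. Validity at every positive [x] is what permits
    iteration down to [x / 2 ^ n]. *)
Lemma tail_halving :
  exists2 K : R, 1 <= K & forall x, 0 < x -> G (x / 2) <= K * G x.
Proof.
have h0 : (0 : R) < 2^-1 by rewrite invr_gt0.
have [z z0 Hz] := @tail_ratio_lt _ (2^-1 `^ (- alpha) + 1) h0 (ltr_pwDr ltr01 (lexx _)).
have Gz := tail_gt0 z0.
exists (Num.max (2^-1 `^ (- alpha) + 1) (Num.max 1 (G z)^-1)).
  by rewrite !le_max lexx orbT.
move=> x xgt0; have Gx := tail_gt0 xgt0.
have [xz|/ltW zx] := leP x z.
  rewrite (le_trans (G_le1 _))// -ler_pdivrMr// mul1r !le_max.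
  by apply/orP; right; apply/orP; right; rewrite lef_pV2 ?posrE// G_ninc.
by rewrite [x / 2]mulrC (le_trans (Hz _ zx))// ler_wpM2r ?(ltW Gx)// le_max lexx.
Qed.

(** With [c = (1 + eta/2)^(-1/alpha)] the limiting ratio [c^(-alpha)] is [1 + eta/2], strictly below
    [1 + eta]. The gap [1 - c] later pays for the small claims and for the premium. *)
Lemma tail_scale_near1 (eta : R) : 0 < eta ->
  exists c, [/\ 0 < c, c < 1 & exists2 x0 : R, 0 < x0 &
    forall x, x0 <= x -> G (c * x) <= (1 + eta) * G x].
Proof.
move=> eta0; pose a := 1 + eta / 2; have a1 : 1 < a by rewrite /a ltrDl divr_gt0.
have a0 := lt_trans ltr01 a1; exists (a `^ (- alpha^-1)).
have c0 : 0 < a `^ (- alpha^-1) by rewrite powR_gt0.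
split => //.
  rewrite powRN invf_lt1 ?powR_gt0//.
  have -> : (1 : R) = 1 `^ alpha^-1 by rewrite powR1.
  by rewrite gt0_ltr_powR ?invr_gt0 ?nnegrE ?ler01 ?(ltW a0).
apply: tail_ratio_lt => //.
rewrite -powRrM mulrNN mulVf ?gt_eqF// powRr1 ?ltW// /a ltrD2l; lra.
Qed.

End regular_variation.

Lemma halving_iter {R : realFieldType} (G : R -> R) (K : R) : 0 <= K ->
  (forall x, 0 < x -> G (x / 2) <= K * G x) ->
  forall n x, 0 < x -> G (x / 2 ^+ n) <= K ^+ n * G x.
Proof.
move=> K0 GK; elim=> [|n IHn] x x0; first by rewrite !expr0 divr1 mul1r.
rewrite exprS invfM mulrA (le_trans (IHn _ _))//.
  by rewrite divr_gt0.
by rewrite exprSr -mulrA ler_wpM2l ?exprn_ge0// GK.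
Qed.

(** * Joint laws restricted to an event *)

Section restricted_law.
Local Open Scope ereal_scope.
Context d (Omega : measurableType d) (R : realType) (P : probability Omega R).

Section definition.
Context d' (E : measurableType d').

(** The measurability proofs are arguments so that the measure structure, which needs them, can be
    attached to the term. With [H] the whole space this is the law of [f]. *)
Definition restr_law (f : Omega -> E) (H : set Omega)
  of measurable_fun setT f & measurable H : set E -> \bar R :=
  fun A => P (f @^-1` A `&` H).

Variables (f : Omega -> E) (H : set Omega).
Hypotheses (mf : measurable_fun setT f) (mH : measurable H).

Let law0 : restr_law mf mH set0 = 0.
Proof. by rewrite /restr_law preimage_set0 set0I measure0. Qed.

Let law_ge0 A : 0 <= restr_law mf mH A.
Proof. exact: measure_ge0. Qed.

Let law_additive : semi_sigma_additive (restr_law mf mH).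
Proof.
move=> F mF tF mU; rewrite /restr_law preimage_bigcup setI_bigcupl.
apply: measure_semi_sigma_additive.
- by move=> n; apply: measurableI => //; rewrite -[_ @^-1` _]setTI; exact: mf.
- apply/trivIsetP => i j _ _ ij; rewrite setIACA setIid -preimage_setI.
  by move/trivIsetP : tF => -> //; rewrite preimage_set0 set0I.
- apply: bigcup_measurable => n _; apply: measurableI => //.
  by rewrite -[_ @^-1` _]setTI; exact: mf.
Qed.

HB.instance Definition _ :=
  isMeasure.Build _ _ _ (restr_law mf mH) law0 law_ge0 law_additive.

Let law_fin : fin_num_fun (restr_law mf mH).
Proof.
move=> A mA; rewrite fin_num_measure//; apply: measurableI => //.
by rewrite -[_ @^-1` _]setTI; exact: mf.
Qed.

HB.instance Definition _ :=
  Measure_isFinite.Build _ _ _ (restr_law mf mH) law_fin.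

End definition.

Context d1 d2 (E1 : measurableType d1) (E2 : measurableType d2).
Variables (X : Omega -> E1) (Y : Omega -> E2) (H : set Omega).
Hypotheses (mX : measurable_fun setT X) (mY : measurable_fun setT Y).
Hypothesis mH : measurable H.
Hypothesis XYH : forall A B, measurable A -> measurable B ->
  P (X @^-1` A `&` (Y @^-1` B `&` H)) = P (X @^-1` A) * P (Y @^-1` B `&` H).

(** By [XYH] the restricted joint law agrees on rectangles with a product measure, hence everywhere;
    the right-hand side is that product computed by sections. Keeping [H] lets a cylinder event ride
    through the induction on arrival times. *)
Lemma restr_pair_law C : measurable C ->
  P ([set w | C (X w, Y w)] `&` H) =
  \int[restr_law mX measurableT]_x P (Y @^-1` xsection C x `&` H).
Proof.
move=> mC.
have mXY : measurable_fun setT (fun w => (X w, Y w)) by exact: measurable_fun_pair.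
apply/esym/(@product_measure_unique _ _ _ _ _ (restr_law mX measurableT)
  (restr_law mY mH) (restr_law mXY mH)) => // A B mA mB.
rewrite /= /restr_law setIT -XYH// setIA; congr (P _).
Qed.

End restricted_law.

(** * Independence of arrival times from later variables *)

Section arrival_times.
Local Open Scope ereal_scope.
Context d (Omega : measurableType d) (R : realType) (P : probability Omega R).
Variable V : nat + nat -> Omega -> R.
Hypothesis mV : forall i, measurable_fun setT (V i).
Hypothesis indV : mutual_indep P V.

Local Notation W := (fun k => V (inl k)).
Local Notation cyl J B := (\bigcap_(j in [set` J]) (V j @^-1` B j)).

Lemma measurable_theta k : measurable_fun setT (theta W k).
Proof.
rewrite (_ : theta W k = fun w => (\sum_(i < k) V (inl (i : nat)) w)%R)//.
by apply: measurable_sum => i; exact: mV.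
Qed.

Lemma thetaS k w : theta W k.+1 w = (theta W k w + V (inl k) w)%R.
Proof. by rewrite /theta big_ord_recr. Qed.

Lemma measurable_preimageT d' (E : measurableType d') (f : Omega -> E) A :
  measurable_fun setT f -> measurable A -> measurable (f @^-1` A).
Proof. by move=> mf mA; rewrite -[_ @^-1` _]setTI; exact: mf. Qed.

Lemma measurable_cyl (J : seq (nat + nat)) (B : nat + nat -> set R) :
  (forall j, measurable (B j)) -> measurable (cyl J B).
Proof.
move=> mB; apply: fin_bigcap_measurable => [|j _]; [exact: finite_seq|exact: measurable_preimageT].
Qed.

Lemma set_seq_cons (T : eqType) (i : T) J : [set` i :: J] = i |` [set` J].
Proof.
apply/seteqP; split => j /=; rewrite inE; first by move=> /predU1P.
by move=> [->|->]; rewrite ?eqxx ?orbT.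
Qed.

Lemma mutual_indep_cons i J A (B : nat + nat -> set R) :
  measurable A -> (forall j, measurable (B j)) -> uniq (i :: J) ->
  P (V i @^-1` A `&` cyl J B) = P (V i @^-1` A) * P (cyl J B).
Proof.
move=> mA mB /[dup] uiJ /= /andP[iJ uJ].
pose B' j := if j == i then A else B j.
have mB' j : measurable (B' j) by rewrite /B'; case: ifP.
have BB' j : j \in J -> B' j = B j.
  by move=> jJ; rewrite /B' ifN//; apply: contraNneq iJ => <-.
transitivity (P (cyl (i :: J) B')).
  congr (P _); rewrite set_seq_cons bigcap_setU1 {1}/B' eqxx; congr (_ `&` _).
  by apply: eq_bigcapr => j /= jJ; rewrite BB'.
rewrite indV// big_cons {1}/B' eqxx indV//; congr (_ * _).
by apply: eq_big_seq => j jJ; rewrite BB'.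
Qed.

(** Integrating over the last summand of [theta W k.+1] leaves an event on [theta W k], to which the
    induction hypothesis applies. The cylinder is arbitrary because the step enlarges it by the
    index [inl k]. *)
Lemma theta_indep_cyl k J (B : nat + nat -> set R) A :
  uniq J -> (forall i, (i < k)%N -> inl i \notin J) ->
  (forall j, measurable (B j)) -> measurable A ->
  P (theta W k @^-1` A `&` cyl J B) = P (theta W k @^-1` A) * P (cyl J B).
Proof.
elim: k J B A => [|k IHk] J B A uJ kJ mB mA.
  have -> : theta W 0 @^-1` A = [set w | A 0%R].
    by apply/seteqP; split => w; rewrite /preimage/= /theta big_ord0.
  have [A0|A0] := pselect (A 0%R).
    rewrite (_ : [set _ | _] = setT) ?setTI ?probability_setT ?mul1e//.
    by apply/seteqP; split.
  rewrite (_ : [set _ | _] = set0) ?set0I ?measure0 ?mul0e//.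
  by apply/seteqP; split.
pose C := [set xy : R * R | A (xy.2 + xy.1)%R].
have mC : measurable C.
  rewrite -[C]setTI.
  have mD : measurable_fun setT (fun xy : R * R => (xy.2 + xy.1)%R).
    by apply: measurable_funD; [exact: measurable_snd|exact: measurable_fst].
  exact: mD.
have E : theta W k.+1 @^-1` A = [set w | C (V (inl k) w, theta W k w)].
  by apply/seteqP; split => w; rewrite /preimage/= thetaS.
(* [I] depends on neither [J'] nor [B']; the empty cylinder, used at the end, identifies it with the
   probability of the event on [theta W k.+1]. *)
pose I := \int[restr_law P (mV (inl k)) measurableT]_x
  P (theta W k @^-1` xsection C x).
have main J' B' : uniq J' -> (forall i, (i < k.+1)%N -> inl i \notin J') ->
    (forall j, measurable (B' j)) ->
    P (theta W k.+1 @^-1` A `&` cyl J' B') = I * P (cyl J' B').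
  move=> uJ' kJ' mB'; rewrite E (restr_pair_law (mV (inl k)) (measurable_theta k))//.
  - rewrite -ge0_integralZr//.
      apply: eq_integral => x _; apply: IHk => //.
        by move=> i ik; apply: kJ'; exact: leqW.
      exact: measurable_xsection.
    have := measurable_fun_xsection (restr_law P (measurable_theta k) measurableT) mC.
    apply: eq_measurable_fun => x _ /=.
    by rewrite /restr_law setIT.
  - exact: measurable_cyl.
  (* The event on [V (inl k)] joins the cylinder, the induction hypothesis splits off [theta W k],
     and [mutual_indep_cons] then splits off [V (inl k)]. *)
  - move=> A1 A2 mA1 mA2.
    pose B2 j := if j == inl k then A1 else B' j.
    have mB2 j : measurable (B2 j) by rewrite /B2; case: ifP.
    have BB j : j \in J' -> B2 j = B' j.
      by move=> jJ; rewrite /B2 ifN//; apply: contraNneq (kJ' k (ltnSn k)) => <-.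
    have cE : cyl (inl k :: J') B2 = V (inl k) @^-1` A1 `&` cyl J' B'.
      rewrite set_seq_cons bigcap_setU1 {1}/B2 eqxx; congr (_ `&` _).
      by apply: eq_bigcapr => j /= jJ; rewrite BB.
    rewrite setICA -cE IHk//; first last.
    + move=> i ik; rewrite inE negb_or (kJ' i (leqW ik)) andbT.
      by apply/eqP => -[ik']; rewrite ik' ltnn in ik.
    + by rewrite /= uJ' (kJ' k (ltnSn k)).
    rewrite cE mutual_indep_cons//; last by rewrite /= uJ' (kJ' k (ltnSn k)).
    rewrite IHk// 1?muleCA//.
    by move=> i ik; exact: kJ' (leqW ik).
rewrite main//; congr (_ * _).
have := main [::] B isT (fun _ _ => isT) mB.
by rewrite set_nil bigcap_set0 setIT probability_setT mule1.
Qed.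

End arrival_times.

Section lebesgue_translation.
Local Open Scope ereal_scope.
Context {R : realType}.
Local Notation mu := (@lebesgue_measure R).

(** The image of Lebesgue measure under the shift has the right value on half-open intervals, which
    determine the measure. *)
Lemma ge0_integral_translation (u : R) (f : R -> \bar R) :
  measurable_fun setT f -> (forall x, 0 <= f x) ->
  \int[mu]_x f (x - u)%R = \int[mu]_x f x.
Proof.
move=> mf f0.
have mg : @measurable_fun _ _ (measurableTypeR R) (measurableTypeR R) setT
  (fun x : R => x - u)%R by exact: measurable_funB.
pose g : {mfun measurableTypeR R >-> measurableTypeR R} :=
  @mfun_Sub _ _ (measurableTypeR R) (measurableTypeR R) _ (mem_set mg).
transitivity (\int[pushforward mu g]_x f x).
  by rewrite ge0_integral_pushforward//= preimage_setT.
apply: (@eq_measure_integral _ _ R setT mu) => A mA _; apply/esym.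
apply: (@lebesgue_measure_unique _ (pushforward mu g)) => //= _ [[a b]] _ <-.
rewrite /pushforward/= (_ : g @^-1` _ = `](a + u)%R, (b + u)%R]%classic).
  rewrite !lebesgue_measure_itv/= !lte_fin ltrD2r.
  by case: ifP => // _; rewrite -!EFinB; congr _%:E; ring.
by apply/seteqP; split => x /=; rewrite !in_itv/= ltrBrDr lerBlDr.
Qed.

End lebesgue_translation.

(** * The density of arrival times *)

Section arrival_density.
Local Open Scope ereal_scope.
Context d (Omega : measurableType d) (R : realType) (P : probability Omega R).
Variables (lambda : R) (V : nat + nat -> Omega -> R).
Hypothesis lambda_gt0 : (0 < lambda)%R.
Hypothesis mV : forall i, measurable_fun setT (V i).
Hypothesis indV : mutual_indep P V.
Hypothesis expV : forall k A, measurable A ->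
  P (V (inl k) @^-1` A) = exponential_prob lambda A.

Local Notation W := (fun k => V (inl k)).
Local Notation mu := (@lebesgue_measure R).

Lemma interarrival_lt0 k : P (V (inl k) @^-1` [set x : R | (x < 0)%R]) = 0.
Proof.
rewrite -set_itvNyo expV// /exponential_prob integral0_eq// => x /=.
by rewrite in_itv/= => x0; rewrite lt0_exponential_pdf.
Qed.

Lemma interarrival_le0 k : P (V (inl k) @^-1` [set x : R | (x <= 0)%R]) = 0.
Proof.
have -> : [set x : R | (x <= 0)%R] = [set 0%R] `|` [set x : R | (x < 0)%R].
  apply/seteqP; split => x /=; first by rewrite le_eqVlt => /predU1P.
  by move=> [->|/ltW].
have m0 : measurable (V (inl k) @^-1` [set 0%R]) by exact: measurable_preimageT.
have mlt : measurable (V (inl k) @^-1` [set x : R | (x < 0)%R]).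
  by rewrite -set_itvNyo; exact: measurable_preimageT.
apply/eqP; rewrite -measure_le0 preimage_setU (le_trans (measureU2 _ m0 mlt))//.
by rewrite /= interarrival_lt0 adde0 expV// /exponential_prob integral_set1.
Qed.

Lemma interarrival_tail k y : (0 <= y)%R ->
  P (V (inl k) @^-1` [set x : R | (y < x)%R]) = (expR (- lambda * y))%:E.
Proof.
move=> y0.
have -> : V (inl k) @^-1` [set x : R | (y < x)%R] = ~` (V (inl k) @^-1` [set x : R | (x <= y)%R]).
  by apply/seteqP; split => w /=; rewrite ltNge => /negP.
rewrite probability_setC; last by rewrite -set_itvNyc; exact: measurable_preimageT.
have [y00|y_gt0] := eqVneq y 0%R.
  by rewrite y00 interarrival_le0 sube0 mulr0 expR0.
have {}y0 : (0 < y)%R by rewrite lt_neqAle eq_sym y_gt0.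
have -> : [set x : R | (x <= y)%R] = [set x : R | (x < 0)%R] `|` `[0%R, y]%classic.
  apply/seteqP; split => x /=; rewrite in_itv/=.
    by move=> ->; rewrite andbT; case: ltP; [left|right].
  by move=> [x0|/andP[]//]; rewrite ltW// (lt_trans x0).
rewrite preimage_setU measureU//.
- rewrite /= interarrival_lt0 add0e expV// exponential_prob_itv0c//.
  by rewrite -EFinB subKr.
- rewrite -set_itvNyo; exact: measurable_preimageT.
- exact: measurable_preimageT.
- by apply/seteqP; split => w //= []; rewrite in_itv/= ltNge => /negP + /andP[].
Qed.

(** The hazard rate of the exponential law is constant: its density is [lambda] times its tail. For
    [x < u] both sides vanish. *)
Lemma exponential_pdf_shift k x u :
  (exponential_pdf lambda (x - u))%:E =
  lambda%:E * P (V (inl k) @^-1` [set w | (u <= x < u + w)%R]).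
Proof.
have [ux|xu] := leP u x; last first.
  rewrite lt0_exponential_pdf ?subr_lt0// (_ : [set w | _] = set0).
    by rewrite preimage_set0 measure0 mule0.
  by apply/seteqP; split => w //=; rewrite leNgt xu.
rewrite exponential_pdfE ?subr_ge0// EFinM -(interarrival_tail k) ?subr_ge0//.
congr (_ * P (_ @^-1` _)).
by apply/seteqP; split => w /=; rewrite ltrBlDl.
Qed.

(** The law of [theta W k.+1] is a convolution with the exponential density. After Tonelli,
    [exponential_pdf_shift] reads the inner integral at fixed [x] as the chance that [x] falls
    between two consecutive arrivals; no gamma density or Poisson weight is computed. *)
Lemma arrival_density k B : measurable B ->
  P (theta W k.+1 @^-1` B) =
  \int[mu]_(x in B) (lambda%:E * P [set w | (theta W k w <= x < theta W k.+1 w)%R]).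
Proof.
move=> mB.
have indW A1 A2 : measurable A1 -> measurable A2 ->
    P (theta W k @^-1` A1 `&` (V (inl k) @^-1` A2 `&` setT)) =
    P (theta W k @^-1` A1) * P (V (inl k) @^-1` A2 `&` setT).
  move=> mA1 mA2.
  have := @theta_indep_cyl _ _ _ _ _ mV indV k [:: inl k] (fun=> A2) A1.
  rewrite set_cons1 bigcap_set1 setIT; apply => //.
  by move=> i ik; rewrite inE; apply/eqP => -[E]; rewrite E ltnn in ik.
have mth k' := measurable_theta mV k'.
have pairE C : measurable C ->
    P [set w | C (theta W k w, V (inl k) w)] =
    \int[restr_law P (mth k) measurableT]_x P (V (inl k) @^-1` xsection C x).
  move=> mC; have := restr_pair_law (mth k) (mV (inl k)) measurableT indW mC.
  by rewrite setIT => ->; apply: eq_integral => x _; rewrite setIT.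
have madd : measurable_fun setT (fun xy : R * R => xy.1 + xy.2)%R.
  by apply: measurable_funD; [exact: measurable_fst|exact: measurable_snd].
have := pairE ((fun xy : R * R => xy.1 + xy.2)%R @^-1` B)
  (measurable_preimageT madd mB).
rewrite (_ : [set w | _] = theta W k.+1 @^-1` B); last first.
  by apply/seteqP; split => w; rewrite /preimage/= thetaS.
move=> ->.
pose h (ux : R * R) := (\1_B ux.2 * exponential_pdf lambda (ux.2 - ux.1))%:E.
have mh : measurable_fun setT h.
  apply/measurable_EFinP; apply: measurable_funM.
    have mi : measurable_fun setT (\1_B : R -> R) by exact: measurable_indic.
    exact: (measurableT_comp mi measurable_snd).
  apply: (measurableT_comp (measurable_exponential_pdf lambda)).
  by apply: measurable_funB; [exact: measurable_snd|exact: measurable_fst].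
have h0 ux : 0 <= h ux.
  by rewrite lee_fin mulr_ge0// exponential_pdf_ge0// ltW.
transitivity (\int[restr_law P (mth k) measurableT]_u \int[mu]_x h (u, x)).
  apply: eq_integral => u _.
  have msec : measurable (xsection ((fun xy : R * R => xy.1 + xy.2)%R @^-1` B) u).
    by apply: measurable_xsection; exact: (measurable_preimageT madd mB).
  (* The variable changes from the waiting time to the arrival time [x], which Tonelli can then hold
     fixed. *)
  rewrite expV// /exponential_prob integral_mkcond/= -(ge0_integral_translation u).
  - apply: eq_integral => x _; rewrite /h /= patchE indicE.
    rewrite (_ : (_ \in xsection _ _) = (x \in B)).
      by case: ifP => _; rewrite ?mul1r ?mul0r.
    by rewrite mem_xsection; apply/idP/idP; rewrite !inE/= subrKC.
  - apply/(measurable_restrictT _ msec)/measurable_EFinP/measurable_funTS.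
    exact: measurable_exponential_pdf.
  - move=> x; rewrite patchE; case: ifP => // _.
    by rewrite lee_fin exponential_pdf_ge0// ltW.
rewrite fubini_tonelli//=.
rewrite [RHS]integral_mkcond; apply: eq_integral => x _.
rewrite patchE; case: ifPn => xB; last first.
  rewrite integral0_eq// => u _.
  by rewrite /h /= indicE (negbTE xB) mul0r.
transitivity (\int[restr_law P (mth k) measurableT]_u
   (lambda%:E * P (V (inl k) @^-1` [set w | (u <= x < u + w)%R]))).
  apply: eq_integral => u _.
  by rewrite -exponential_pdf_shift /h /= indicE xB mul1r.
pose C := [set uw : R * R | (uw.1 <= x < uw.1 + uw.2)%R].
have mC : measurable C.
  have -> : C = fst @^-1` [set u | (u <= x)%R] `&`
      (fun xy : R * R => xy.1 + xy.2)%R @^-1` [set z | (x < z)%R].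
    by apply/seteqP; split => -[u w]; rewrite /C/= => /andP.
  apply: measurableI; apply: measurable_preimageT => //.
  - by rewrite -set_itvNyc.
  - by rewrite -set_itvoy.
rewrite ge0_integralZl//; first last.
- by rewrite lee_fin ltW.
- have := measurable_fun_xsection (restr_law P (mV (inl k)) measurableT) mC.
  apply: eq_measurable_fun => u _ /=.
  rewrite /restr_law setIT; congr (P (_ @^-1` _)).
  by apply/seteqP; split => w; rewrite /xsection/= ?inE.
congr (_ * _).
rewrite (_ : [set w | _] = [set w | C (theta W k w, V (inl k) w)]).
  rewrite pairE//; apply: eq_integral => u _; congr (P (_ @^-1` _)).
  by apply/seteqP; split => w; rewrite /xsection/= ?inE.
by apply/seteqP; split => w; rewrite /C/= thetaS.
Qed.

End arrival_density.

(** * Count probabilities and the decay of early arrivals *)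

Section arrival_counts.
Local Open Scope ereal_scope.
Context d (Omega : measurableType d) (R : realType) (P : probability Omega R).
Variables (lambda : R) (V : nat + nat -> Omega -> R).
Hypothesis lambda_gt0 : (0 < lambda)%R.
Hypothesis mV : forall i, measurable_fun setT (V i).
Hypothesis indV : mutual_indep P V.
Hypothesis expV : forall k A, measurable A ->
  P (V (inl k) @^-1` A) = exponential_prob lambda A.

Local Notation W := (fun k => V (inl k)).
Local Notation mu := (@lebesgue_measure R).
Local Notation mth := (measurable_theta mV).

Lemma measurable_le_set (f g : Omega -> R) :
  measurable_fun setT f -> measurable_fun setT g ->
  measurable [set w | (f w <= g w)%R].
Proof.
move=> mf mg; rewrite -[X in measurable X]setTI.
by have /(_ measurableT [set true]) := measurable_fun_ler mf mg; apply.
Qed.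

Lemma measurable_lt_set (f g : Omega -> R) :
  measurable_fun setT f -> measurable_fun setT g ->
  measurable [set w | (f w < g w)%R].
Proof.
move=> mf mg; rewrite -[X in measurable X]setTI.
by have /(_ measurableT [set true]) := measurable_fun_ltr mf mg; apply.
Qed.

Lemma le_probS (A B : set Omega) : measurable A -> measurable B -> A `<=` B ->
  P A <= P B.
Proof. by move=> mA mB AB; apply: le_measure; rewrite ?inE. Qed.

Lemma le_probU (A B C : set Omega) :
  measurable A -> measurable B -> measurable C -> A `<=` B `|` C ->
  P A <= P B + P C.
Proof.
move=> mA mB mC ABC; apply: (@le_trans _ _ (P (B `|` C))).
  by apply: le_measure; rewrite ?inE//; exact: measurableU.
exact: measureU2.
Qed.

Lemma measurable_theta_le k x : measurable [set w | (theta W k w <= x)%R].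
Proof. exact: measurable_le_set (mth k) (measurable_cst x). Qed.

Lemma measurable_Ncount k x : measurable [set w | Ncount W x w k].
Proof.
rewrite (_ : [set w | _] = [set w | (theta W k w <= x)%R] `&` [set w | (x < theta W k.+1 w)%R]).
  apply: measurableI; first exact: measurable_theta_le.
  exact: measurable_lt_set (measurable_cst x) (mth _).
by apply/seteqP; split => w /andP.
Qed.

Lemma measurable_interarrival_le0 k : measurable [set w | (V (inl k) w <= 0)%R].
Proof. exact: measurable_le_set (measurable_cst _). Qed.

Lemma prob_interarrival_le0 k : P [set w | (V (inl k) w <= 0)%R] = 0.
Proof. exact: interarrival_le0 expV k. Qed.

Lemma theta_lt0 k x : (x < 0)%R -> P [set w | (theta W k w <= x)%R] = 0.
Proof.
move=> x0; elim: k => [|k IHk].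
  rewrite (_ : [set w | _] = set0) ?measure0//.
  by apply/seteqP; split => w //=; rewrite /theta big_ord0 leNgt x0.
apply/eqP; rewrite -measure_le0.
rewrite (le_trans (le_probU (measurable_theta_le k.+1 x)
  (measurable_theta_le k x) (measurable_interarrival_le0 k) _))//; last first.
  by rewrite IHk prob_interarrival_le0 adde0.
move=> w /=; rewrite thetaS; have [?|] := leP (V (inl k) w) 0%R; first by right.
by move=> w0 ?; left; lra.
Qed.

(** [theta W k.+1 w <= x] can hold without [theta W k w <= x] only where [V (inl k) w <= 0], a null
    event. The identity is the telescoping step of [sum_Ncount]. *)
Lemma Ncount_theta k x :
  P [set w | Ncount W x w k] + P [set w | (theta W k.+1 w <= x)%R] =
  P [set w | (theta W k w <= x)%R].
Proof.
pose B := [set w | (theta W k w <= x)%R] `&` [set w | (theta W k.+1 w <= x)%R].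
have mB : measurable B by apply: measurableI; exact: measurable_theta_le.
have -> : [set w | (theta W k w <= x)%R] = [set w | Ncount W x w k] `|` B.
  apply/seteqP; split => w; rewrite /B /Ncount/=.
    by move=> ->; case: ltP; [left|right].
  by case=> [/andP[]|[]].
rewrite measureU//=.
- congr (_ + _); apply/eqP; rewrite eq_le; apply/andP; split; last first.
    apply: (le_probS mB (measurable_theta_le k.+1 x)).
    by rewrite /B; exact: subIsetr.
  rewrite (le_trans (le_probU (measurable_theta_le k.+1 x)
    mB (measurable_interarrival_le0 k) _))//; last first.
    by rewrite prob_interarrival_le0 adde0.
  move=> w /=; rewrite /B/= thetaS; have [?|] := leP (V (inl k) w) 0%R; first by right.
  by move=> w0 ?; left; split => //; lra.
- exact: measurable_Ncount.
- by apply/seteqP; split => w //= []; rewrite /B/Ncount/= => /andP[_]; rewrite ltNge => /negP + [].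
Qed.

Lemma sum_Ncount m x : (0 <= x)%R ->
  \sum_(k < m) P [set w | Ncount W x w k] + P [set w | (theta W m w <= x)%R] = 1.
Proof.
move=> x0; elim: m => [|m IHm].
  rewrite big_ord0 add0e (_ : [set w | _] = setT) ?probability_setT//.
  by apply/seteqP; split => w //= _; rewrite /theta big_ord0.
by rewrite big_ord_recr /= -addeA Ncount_theta.
Qed.

Lemma Ncount_lt0 k x : (x < 0)%R -> P [set w | Ncount W x w k] = 0.
Proof.
move=> x0; apply/eqP; rewrite -measure_le0 -(theta_lt0 k x0).
apply: (le_probS (measurable_Ncount k _) (measurable_theta_le k _)).
by move=> w /andP[].
Qed.

Lemma measurable_fun_Ncount k :
  measurable_fun setT (fun x => P [set w | Ncount W x w k]).
Proof.
pose C := [set xw : R * Omega | Ncount W xw.1 xw.2 k].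
have mC : measurable C.
  have mt k' : measurable_fun setT (fun xw : R * Omega => theta W k' xw.2).
    exact: measurableT_comp (mth k') measurable_snd.
  have -> : C = [set xw | (theta W k xw.2 <= xw.1)%R] `&`
                [set xw | (xw.1 < theta W k.+1 xw.2)%R].
    by apply/seteqP; split => w /andP.
  apply: measurableI; rewrite -[X in measurable X]setTI.
    by have /(_ measurableT [set true]) := measurable_fun_ler (mt k) measurable_fst; apply.
  by have /(_ measurableT [set true]) := measurable_fun_ltr measurable_fst (mt k.+1); apply.
have := measurable_fun_xsection P mC.
apply: eq_measurable_fun => u _ /=; congr (P _).
by apply/seteqP; split => w; rewrite /xsection/= inE.
Qed.

Lemma arrival_density0 k B : measurable B ->
  P (theta W k.+1 @^-1` B) =
  \int[mu]_(x in B `&` `[0%R, +oo[) (lambda%:E * P [set w | Ncount W x w k]).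
Proof.
move=> mB; rewrite (arrival_density lambda_gt0 mV indV expV)//.
rewrite integral_mkcond [RHS]integral_mkcond; apply: eq_integral => x _.
rewrite !patchE in_setI; case: (x \in B) => //=.
rewrite mem_setE in_itv/= andbT; case: leP => // x0.
by rewrite Ncount_lt0// mule0.
Qed.

Lemma integral_expR_itv (s x : R) : (0 < s)%R -> (0 < x)%R ->
  \int[mu]_(u in `[0%R, x]) (s * expR (s * u))%:E = (expR (s * x) - 1)%:E.
Proof.
(* The formula for the exponential law is taken at the negative rate [- s], where its integrand is
   the negative of the present one. *)
move=> s0 x0; have := exponential_prob_itv0c (- s)%R x0.
rewrite /exponential_prob opprK => E.
rewrite -[LHS]oppeK -integral_ge0N; last first.
  by move=> u _; rewrite lee_fin mulr_ge0 ?expR_ge0// ltW.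
rewrite -(opprB 1%R) EFinN EFinB -E; congr (- _).
apply: eq_integral => u; rewrite inE/= in_itv/= => /andP[u0 _].
by rewrite exponential_pdfE// opprK mulNr EFinN.
Qed.

(* A Chernoff bound: [s] is free, so the decay in [k] beats any geometric rate. *)
Lemma theta_le_expR k (s x : R) : (0 < s)%R -> (0 <= x)%R ->
  P [set w | (theta W k w <= x)%R] <= ((lambda / s) ^+ k * expR (s * x))%:E.
Proof.
move=> s0; elim: k x => [|k IHk] x x0.
  rewrite expr0 mul1r (le_trans (probability_le1 P _))//.
    exact: measurable_theta_le.
  by rewrite lee_fin -expR0 ler_expR mulr_ge0// ltW.
have q0 : (0 <= lambda / s)%R by rewrite divr_ge0// ltW.
have -> : [set w | (theta W k.+1 w <= x)%R] = theta W k.+1 @^-1` `]-oo, x]%classic.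
  by apply/seteqP; split => w /=; rewrite in_itv.
rewrite arrival_density0//.
have -> : `]-oo, x]%classic `&` `[0%R, +oo[%classic = `[0%R, x]%classic :> set R.
  by apply/seteqP; split => u /=; rewrite !in_itv/= andbT; [move=> [-> ->]|move=> /andP[]].
have [x00|xn0] := eqVneq x 0%R.
  rewrite x00 set_itv1 integral_set1 lee_fin.
  by rewrite mulr_ge0 ?exprn_ge0 ?expR_ge0.
have {xn0}x0' : (0 < x)%R by rewrite lt_neqAle eq_sym xn0.
(* Since [P (N u = k) <= P (theta k <= u)], the induction hypothesis bounds the density by
   [lambda * (lambda / s)^k * e^(s u)], here rewritten so that [s * e^(s u)] integrates exactly. *)
apply: (@le_trans _ _ (\int[mu]_(u in `[0%R, x])
  (((lambda / s) ^+ k.+1)%:E * (s * expR (s * u))%:E))).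
  apply: ge0_le_integral => //.
  - by move=> u _; rewrite mule_ge0// lee_fin ltW.
  - by apply: measurable_funTS; apply: measurable_funeM; exact: measurable_fun_Ncount.
  - apply: measurable_funTS; apply: measurable_funeM; apply/measurable_EFinP.
    apply: measurable_funM => //.
    by apply: measurableT_comp => //; exact: measurable_funM.
  - move=> u; rewrite /= in_itv/= => /andP[u0 _].
    apply: (@le_trans _ _ (lambda%:E * ((lambda / s) ^+ k * expR (s * u))%:E)).
      rewrite lee_wpmul2l ?lee_fin ?(ltW lambda_gt0)//.
      apply: le_trans (IHk _ u0).
      apply: (le_probS (measurable_Ncount k _) (measurable_theta_le k _)).
      by move=> w /andP[].
    rewrite -!EFinM lee_fin exprSr le_eqVlt; apply/orP; left; apply/eqP.
    by field; rewrite gt_eqF.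
rewrite ge0_integralZl//; last first.
- by rewrite lee_fin exprn_ge0.
- by move=> u _; rewrite lee_fin mulr_ge0 ?expR_ge0// ltW.
- apply: measurable_funTS; apply/measurable_EFinP; apply: measurable_funM => //.
  by apply: measurableT_comp => //; exact: measurable_funM.
rewrite integral_expR_itv// -EFinM lee_fin ler_wpM2l ?exprn_ge0//; lra.
Qed.

End arrival_counts.

(** * Integration against a scaled, restricted measure *)

Section scaled_restriction.
Local Open Scope ereal_scope.
Context d d' (X : measurableType d) (Y : measurableType d') (R : realType).
Context (m : {measure set X -> \bar R}) (phi : X -> Y) (mphi : measurable_fun setT phi).

(** Stated for a bare set function because [unif0T] is one; there [phi] is the identity between two
    copies of the real line as a measurable space. *)
Lemma ge0_integral_scaled_restriction (D : set X) (a : R) (f : Y -> \bar R) :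
  measurable D -> (0 <= a)%R -> measurable_fun setT f -> (forall v, 0 <= f v) ->
  \int[fun A => a%:E * m (phi @^-1` A `&` D)]_v f v =
  a%:E * \int[m]_(v in D) f (phi v).
Proof.
move=> mD a0 mf f0.
have mfphi : measurable_fun setT (f \o phi) by exact: measurableT_comp.
transitivity (\int[mscale (NngNum a0) (mrestr m mD)]_v f (phi v)).
  have := ge0_integral_pushforward mphi (mscale (NngNum a0) (mrestr m mD))
    measurableT mf (fun y _ => f0 y).
  by rewrite preimage_setT; exact.
transitivity (a%:E * \int[mrestr m mD]_v f (phi v)).
  exact: (ge0_integral_mscale (mrestr m mD) measurableT (NngNum a0) mfphi
    (fun v _ => f0 _)).
congr (_ * _).
rewrite (@ge0_negligible_integral _ _ _ (mrestr m mD) _ (~` D))//.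
- by rewrite setDE setCK setTI; apply: eq_measure_integral => A mA AD; rewrite /= /mrestr setIidl.
- exact: measurableC.
- by rewrite /= /mrestr setICl measure0.
Qed.

End scaled_restriction.

(** * Expected number of large discounted claims *)

Section discounted_claims.
Local Open Scope ereal_scope.
Context d (Omega : measurableType d) (R : realType) (P : probability Omega R).
Variables (lambda : R) (V : nat + nat -> Omega -> R).
Hypothesis lambda_gt0 : (0 < lambda)%R.
Hypothesis mV : forall i, measurable_fun setT (V i).
Hypothesis indV : mutual_indep P V.
Hypothesis expV : forall k A, measurable A ->
  P (V (inl k) @^-1` A) = exponential_prob lambda A.
Hypothesis idV : forall k A, measurable A ->
  P (V (inr k) @^-1` A) = P (V (inr 1%N) @^-1` A).
Variables (r T : R).
Hypotheses (r_gt0 : (0 < r)%R) (T_gt0 : (0 < T)%R).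

Local Notation W := (fun k => V (inl k)).
Local Notation mu := (@lebesgue_measure R).
Local Notation mth := (measurable_theta mV).
Local Notation G y := (P [set w | (y < V (inr 1%N) w)%R]).

Definition tail_average (y : R) : \bar R :=
  \int[mu]_(x in `[0%R, T]) G (y * expR (r * x))%R.

Definition big_claim k (y : R) : set Omega :=
  [set w | (theta W k w <= T)%R /\ (y < expR (- r * theta W k w) * V (inr k) w)%R].

Lemma measurable_big_claim k y : measurable (big_claim k y).
Proof.
rewrite (_ : big_claim k y = [set w | (theta W k w <= T)%R] `&`
    [set w | (y < expR (- r * theta W k w) * V (inr k) w)%R]).
  apply: measurableI; first exact: (measurable_theta_le mV).
  apply: measurable_lt_set => //; apply: measurable_funM; last exact: mV.
  by apply: measurableT_comp => //; apply: measurable_funM => //; exact: mth.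
by apply/seteqP; split.
Qed.

Lemma tailE k y : P [set w | (y < V (inr k) w)%R] = G y.
Proof.
by have := @idV k `]y, +oo[%classic (measurable_itv _); rewrite set_itvoy.
Qed.

Lemma measurable_tail : measurable_fun setT (fun y : R => G y).
Proof.
pose C := [set xw : R * Omega | (xw.1 < V (inr 1%N) xw.2)%R].
have mC : measurable C.
  rewrite -[C]setTI.
  have mt : measurable_fun setT (fun xw : R * Omega => V (inr 1%N) xw.2).
    exact: measurableT_comp (mV _) measurable_snd.
  by have /(_ measurableT [set true]) := measurable_fun_ltr measurable_fst mt; apply.
have := measurable_fun_xsection P mC.
apply: eq_measurable_fun => u _ /=; congr (P _).
by apply/seteqP; split => w; rewrite /xsection/= inE.
Qed.

Lemma measurable_tail_expR y D :
  measurable_fun D (fun x : R => G (y * expR (r * x))%R).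
Proof.
apply: measurable_funTS.
apply: (measurableT_comp measurable_tail); apply: measurable_funM => //.
by apply: measurableT_comp => //; exact: measurable_funM.
Qed.

(** The claim is independent of its arrival time, whose law has the density found above. At arrival
    time [x] the level [y] for the discounted claim is the level [y * e^(r x)] for the claim
    itself. *)
Lemma prob_big_claim k y :
  P (big_claim k.+1 y) = \int[mu]_(x in `[0%R, T])
    (lambda%:E * P [set w | Ncount W x w k] * G (y * expR (r * x))%R).
Proof.
pose S := V (inr k.+1).
have indS A1 A2 : measurable A1 -> measurable A2 ->
    P (S @^-1` A1 `&` (theta W k.+1 @^-1` A2 `&` setT)) =
    P (S @^-1` A1) * P (theta W k.+1 @^-1` A2 `&` setT).
  move=> mA1 mA2; rewrite setIT setIC muleC.
  have := @theta_indep_cyl _ _ _ _ _ mV indV k.+1 [:: inr k.+1] (fun=> A1) A2.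
  by rewrite set_cons1 bigcap_set1; apply.
pose C := [set su : R * R | (su.2 <= T)%R /\ (y < expR (- r * su.2) * su.1)%R].
have mC : measurable C.
  have -> : C = [set su | (su.2 <= T)%R] `&` [set su | (y < expR (- r * su.2) * su.1)%R].
    by apply/seteqP; split.
  apply: measurableI; rewrite -[X in measurable X]setTI.
    have /(_ measurableT [set true]) := @measurable_fun_ler _ _ R setT _ _
      (@measurable_snd _ _ R R) (measurable_cst T); apply => //.
  have mf : measurable_fun setT (fun su : R * R => expR (- r * su.2) * su.1)%R.
    apply: measurable_funM; last exact: measurable_fst.
    by apply: measurableT_comp => //; apply: measurable_funM => //; exact: measurable_snd.
  have /(_ measurableT [set true]) := @measurable_fun_ltr _ _ R setT _ _
      (measurable_cst y) mf; apply => //.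
have := restr_pair_law (mV (inr k.+1)) (mth k.+1) measurableT indS mC.
rewrite setIT => /[dup] E -> {E}.
(* [C] bounds the arrival time only from above; the factor [0 <= su.2] carries the restriction to
   nonnegative times from [arrival_density0]. *)
pose h (su : R * R) := (\1_C su * (0 <= su.2)%R%:R)%:E *
  (lambda%:E * P [set w | Ncount W su.2 w k]).
have h0 su : 0 <= h su.
  by apply: mule_ge0; [rewrite lee_fin mulr_ge0|rewrite mule_ge0// lee_fin ltW].
have mh : measurable_fun setT h.
  apply: emeasurable_funM.
    apply/measurable_EFinP; apply: measurable_funM; first exact: measurable_indic.
    have mi : measurable_fun setT (\1_(`[0%R, +oo[%classic) : R -> R) by exact: measurable_indic.
    apply: eq_measurable_fun (measurableT_comp mi measurable_snd) => su _ /=.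
    by rewrite indicE mem_setE in_itv/= andbT.
  apply: measurable_funeM.
  exact: measurableT_comp (measurable_fun_Ncount P mV k) measurable_snd.
transitivity (\int[restr_law P (mV (inr k.+1)) measurableT]_s \int[mu]_u h (s, u)).
  apply: eq_integral => s _; rewrite setIT.
  rewrite (arrival_density0 lambda_gt0 mV indV expV); last exact: measurable_xsection.
  rewrite integral_mkcond; apply: eq_integral => u _.
  rewrite patchE in_setI mem_xsection /h /= indicE mem_setE in_itv/= andbT.
  by case: (_ \in C); case: (0 <= u)%R; rewrite /= ?mul1r ?mul0r ?mul1e ?mul0e.
rewrite fubini_tonelli//= [RHS]integral_mkcond; apply: eq_integral => u _.
rewrite patchE mem_setE in_itv/=; case: ifPn => [/andP[u0 uT]|uN]; last first.
  rewrite integral0_eq// => s _; rewrite /h/= indicE.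
  have [u0|u0] := ltP u 0%R; first by rewrite /= mulr0 mul0e.
  rewrite memNset ?mul0r ?mul0e// => -[/= uT _].
  by rewrite u0 uT in uN.
transitivity (\int[restr_law P (mV (inr k.+1)) measurableT]_s
  (lambda%:E * P [set w | Ncount W u w k] * (\1_(`](y * expR (r * u))%R, +oo[%classic) s)%:E)).
  apply: eq_integral => s _.
  rewrite /h/= u0 mulr1 muleC; congr (_ * _%:E); rewrite !indicE; congr ((nat_of_bool _)%:R).
  rewrite mem_setE in_itv/= andbT; apply/idP/idP.
    rewrite inE /C/= => -[_]; rewrite mulNr expRN mulrC.
    by rewrite ltr_pdivlMr ?expR_gt0.
  move=> ys; rewrite inE/C/=; split => //; rewrite mulNr expRN mulrC.
  by rewrite ltr_pdivlMr ?expR_gt0.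
rewrite ge0_integralZl//; last 2 first.
- by apply/measurable_EFinP; exact: measurable_indic.
- by rewrite mule_ge0// lee_fin ltW.
rewrite integral_indic//=; congr (_ * _).
by rewrite -(tailE k.+1) /restr_law !setIT set_itvoy.
Qed.

Lemma sum_big_claim m y :
  \sum_(k < m) P (big_claim k.+1 y) = \int[mu]_(x in `[0%R, T])
   (lambda%:E * (\sum_(k < m) P [set w | Ncount W x w k]) * G (y * expR (r * x))%R).
Proof.
under eq_bigr do rewrite prob_big_claim.
rewrite -ge0_integral_sum//.
- apply: eq_integral => x _.
  rewrite ge0_sume_distrr// ge0_sume_distrl// => i _.
  by rewrite mule_ge0// lee_fin ltW.
- move=> k; apply: emeasurable_funM; last exact: measurable_tail_expR.
  by apply: measurable_funeM; apply: measurable_funTS; exact: measurable_fun_Ncount.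
- by move=> k x _; rewrite !mule_ge0// lee_fin ltW.
Qed.

Lemma tail_averageZ_ge0 a y : (0 <= a)%R ->
  \int[mu]_(x in `[0%R, T]) (a%:E * G (y * expR (r * x))%R) =
  a%:E * tail_average y.
Proof.
by move=> a0; rewrite ge0_integralZl//; exact: measurable_tail_expR.
Qed.

Lemma measurable_count_tail m y D : measurable_fun D (fun x : R =>
  lambda%:E * (\sum_(k < m) P [set w | Ncount W x w k]) * G (y * expR (r * x))%R).
Proof.
apply: emeasurable_funM; last exact: measurable_tail_expR.
apply: measurable_funeM; apply: emeasurable_sum => k; apply: measurable_funTS.
exact: measurable_fun_Ncount.
Qed.

Lemma sum_big_claim_le m y :
  \sum_(k < m) P (big_claim k.+1 y) <= lambda%:E * tail_average y.
Proof.
rewrite sum_big_claim -(tail_averageZ_ge0 _ (ltW lambda_gt0)).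
apply: ge0_le_integral => //.
- by move=> x _; rewrite !mule_ge0// ?sume_ge0// lee_fin ltW.
- exact: measurable_count_tail.
- by apply: measurable_funeM; exact: measurable_tail_expR.
- move=> x; rewrite /= in_itv/= => /andP[x0 _]; rewrite lee_wpmul2r//.
  rewrite -[leRHS]mule1 lee_wpmul2l ?lee_fin ?(ltW lambda_gt0)//.
  by rewrite -(sum_Ncount mV expV m x0) leeDl.
Qed.

(** At time [x] the first [m] count probabilities add up to [1 - P (theta m <= x)], which on
    [[0, T]] is smallest at [x = T]. *)
Lemma sum_big_claim_ge m y :
  (lambda * (1 - fine (P [set w | (theta W m w <= T)%R])))%:E * tail_average y <=
  \sum_(k < m) P (big_claim k.+1 y).
Proof.
set F := fine _.
have mF := measurable_theta_le mV m T.
have FE : F%:E = P [set w | (theta W m w <= T)%R] by rewrite fineK// fin_num_measure.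
have F1 : (0 <= 1 - F)%R.
  by rewrite subr_ge0 -lee_fin FE probability_le1.
rewrite sum_big_claim -tail_averageZ_ge0; last by rewrite mulr_ge0// ltW.
apply: ge0_le_integral => //.
- by move=> x _; rewrite mule_ge0// lee_fin mulr_ge0// ltW.
- by apply: measurable_funeM; exact: measurable_tail_expR.
- exact: measurable_count_tail.
- move=> x; rewrite /= in_itv/= => /andP[x0 xT]; rewrite lee_wpmul2r//.
  rewrite EFinM lee_wpmul2l ?lee_fin ?(ltW lambda_gt0)//.
  rewrite EFinB leeBlDr//.
  rewrite -(sum_Ncount mV expV m x0) leeD2l// FE.
  apply: le_probS => //; first exact: (measurable_theta_le mV).
  by move=> w /= /le_trans; apply.
Qed.

Lemma tail_average_fin y : tail_average y \is a fin_num.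
Proof.
rewrite ge0_fin_numE; last by apply: integral_ge0.
apply: (@le_lt_trans _ _ (\int[mu]_(x in `[0%R, T]) cst 1 x)).
  apply: ge0_le_integral => //; first exact: measurable_tail_expR.
  move=> x _; rewrite probability_le1//.
  exact: measurable_lt_set (measurable_cst _) (mV _).
by rewrite integral_cst//= mul1e lebesgue_measure_itv/= lte_fin T_gt0 ltry.
Qed.

Lemma tail_ninc x y : (x <= y)%R -> G y <= G x.
Proof.
move=> xy; apply: le_probS; [exact: measurable_lt_set..|].
by move=> w /=; exact: le_lt_trans.
Qed.

(** The integrand is smallest at the endpoint [T]. This bound is what makes errors of order [G]
    comparable with the average. *)
Lemma tail_average_ge y : (0 <= y)%R ->
  T%:E * G (y * expR (r * T))%R <= tail_average y.
Proof.
move=> y0.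
have -> : T%:E * G (y * expR (r * T))%R =
    \int[mu]_(x in `[0%R, T]) cst (G (y * expR (r * T))%R) x.
  rewrite integral_cst//= muleC lebesgue_measure_itv/= lte_fin T_gt0.
  by rewrite sube0.
apply: ge0_le_integral => //; first exact: measurable_tail_expR.
move=> x; rewrite /= in_itv/= => /andP[x0 xT]; apply: tail_ninc.
by rewrite ler_wpM2l// ler_expR ler_wpM2l// ltW.
Qed.

(** As [e^(r x) >= 1], every argument [y * e^(r x)] stays above [x0], so the pointwise inequality
    integrates with the same threshold. *)
Lemma tail_average_scale (c b x0 : R) : (0 <= b)%R -> (0 < x0)%R ->
  (forall x, (x0 <= x)%R -> G (c * x)%R <= b%:E * G x) ->
  forall y, (x0 <= y)%R -> tail_average (c * y)%R <= b%:E * tail_average y.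
Proof.
move=> b0 x00 Gc y xy; rewrite -tail_averageZ_ge0//.
apply: ge0_le_integral => //.
- exact: measurable_tail_expR.
- by apply: measurable_funeM; exact: measurable_tail_expR.
- move=> x; rewrite /= in_itv/= => /andP[x_ge0 xT]; rewrite -mulrA; apply: Gc.
  rewrite (le_trans xy)// ler_peMr ?(le_trans (ltW x00))//.
  by rewrite -expR0 ler_expR mulr_ge0// ltW.
Qed.

Lemma tail_average_ninc x y : (x <= y)%R -> tail_average y <= tail_average x.
Proof.
move=> xy; apply: ge0_le_integral => //.
- exact: measurable_tail_expR.
- exact: measurable_tail_expR.
- by move=> u _; apply: tail_ninc; rewrite ler_wpM2r// expR_ge0.
Qed.

(** The section at [v] of the event defining [F_T] has probability [1 - G (x * e^(r v))]. Hence
    [F_T] is [I / T], and [I] and the tail average add up to [T]. *)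
Lemma F_T_barE x : (T * F_T_bar P r T (V (inr 1%N)) x)%R = fine (tail_average x).
Proof.
rewrite /F_T_bar /F_T.
pose D := [set v : R | (0 < v <= T)%R].
have DE : D = `]0%R, T]%classic by apply/seteqP; split => v; rewrite /D/= in_itv.
have mD : measurable D by rewrite DE.
have Ti0 : (0 <= T^-1)%R by rewrite invr_ge0 ltW.
pose I := \int[mu]_(v in D) (1 - G (x * expR (r * v))%R).
have mG y : measurable [set w | (y < V (inr 1%N) w)%R].
  exact: measurable_lt_set (measurable_cst _) (mV _).
have mH : measurable_fun setT (fun v : R => 1 - G (x * expR (r * v))%R).
  by apply: emeasurable_funB => //; exact: measurable_tail_expR.
have H0 v : 0 <= 1 - G (x * expR (r * v))%R.
  by rewrite sube_ge0 ?probability_le1// fin_num_measure.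
have -> : (unif0T T \x P)%E
    [set vw | (expR (- r * vw.1) * V (inr 1%N) vw.2 <= x)%R] = (T^-1)%:E * I.
  have secE : P \o xsection [set vw : R * Omega |
        (expR (- r * vw.1) * V (inr 1%N) vw.2 <= x)%R] =
      (fun v => 1 - G (x * expR (r * v))%R).
    apply/funext => v; rewrite -(probability_setC P (mG _)) [LHS]/=; congr (P _).
    apply/seteqP; split => w.
      rewrite /xsection/= inE/= mulNr expRN mulrC.
      by rewrite ler_pdivrMr ?expR_gt0// leNgt => /negP.
    move=> /negP; rewrite -leNgt /xsection/= inE/= mulNr expRN => ?.
    by rewrite mulrC ler_pdivrMr ?expR_gt0.
  rewrite /product_measure1 secE.
  have mid : @measurable_fun _ _ (measurableTypeR R) R setT id by exact: measurable_id.
  exact: (ge0_integral_scaled_restriction mu mid mD Ti0 mH H0).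
(* The endpoint [0], present here and absent from the support of [V], is Lebesgue-null. *)
have JD : tail_average x = \int[mu]_(v in D) G (x * expR (r * v))%R.
  by rewrite DE integral_itv_obnd_cbnd//; exact: measurable_tail_expR.
have IJ : I + tail_average x = T%:E.
  rewrite JD -ge0_integralD//; last 2 first.
  - exact: measurable_funTS.
  - exact: measurable_tail_expR.
  rewrite (eq_integral (cst 1)); last first.
    by move=> v _ /=; rewrite subeK// fin_num_measure.
  by rewrite DE integral_cst//= mul1e lebesgue_measure_itv/= lte_fin T_gt0 sube0.
have Jfin := tail_average_fin x.
have Ifin : I \is a fin_num.
  by move: IJ; rewrite -(fineK Jfin); case: I.
rewrite -(fineK Ifin) -EFinM/= mulrBr mulr1 mulVKf ?gt_eqF//.
by move: IJ; rewrite -(fineK Ifin) -(fineK Jfin) -EFinD => -[<-]/=; rewrite addrC addKr.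
Qed.

End discounted_claims.

(** If no [a k] exceeds [c * x] and at most one [s k] exceeds [delta * x], the sum is at most
    [c * x + m * delta * x <= x]. Here [a] stands for discounted and [s] for undiscounted claims. *)
Lemma two_large_or_one {R : realFieldType} (a s : nat -> R) (n m : nat) (x c delta : R) :
  (n <= m)%N -> 0 <= x -> 0 <= c -> 0 <= delta -> c + m%:R * delta <= 1 ->
  (forall k, a k <= s k) -> x < \sum_(1 <= k < n.+1) a k ->
  (exists2 k, (k < n)%N & c * x < a k.+1) \/
  (exists i j, [/\ (i < j)%N, (j < n)%N, delta * x < s i.+1 & delta * x < s j.+1]).
Proof.
move=> nm x0 c0 d0 cm as_ xsum.
have [?|noa] := pselect (exists2 k, (k < n)%N & c * x < a k.+1); first by left.
have a_le k : (k < n)%N -> a k.+1 <= c * x.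
  by move=> kn; rewrite leNgt; apply/negP => ck; apply: noa; exists k.
right; apply: contrapT => nos.
have nos' i j : (i < n)%N -> (j < n)%N -> i != j -> delta * x < s i.+1 -> s j.+1 <= delta * x.
  move=> ni nj ij si; rewrite leNgt; apply/negP => sj; apply: nos.
  by move: ij; rewrite neq_ltn => /orP[ij|ji]; [exists i, j|exists j, i].
move: xsum; rewrite big_add1 /= big_mkord; apply/negP; rewrite -leNgt.
have dx0 : 0 <= delta * x by rewrite mulr_ge0.
have nsum (Q : pred 'I_n) : (forall i, Q i -> s i.+1 <= delta * x) ->
    \sum_(i < n | Q i) a i.+1 <= m%:R * (delta * x).
  move=> Hs; apply: (@le_trans _ _ (\sum_(i < n) (delta * x))).
    rewrite [leRHS](bigID Q)/= ler_wpDr ?sumr_ge0//.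
    by apply: ler_sum => i /Hs; apply: le_trans.
  by rewrite sumr_const card_ord -[leLHS]mulr_natl ler_wpM2r// ler_nat.
have cmx : c * x + m%:R * (delta * x) <= x.
  by rewrite mulrA -mulrDl -[leRHS]mul1r ler_wpM2r.
have [[k sk]|none] := pselect (exists k : 'I_n, delta * x < s k.+1).
  rewrite (bigD1 k)//= (le_trans _ cmx)// lerD ?a_le//.
  apply: nsum => i ik; apply: (nos' k) => //.
  by rewrite eq_sym.
rewrite (le_trans _ cmx)// (le_trans (nsum xpredT _))// ?lerDr ?mulr_ge0// => i _.
by rewrite leNgt; apply/negP => si; apply: none; exists i.
Qed.

(** * Elementary real-valued probability bounds *)

Section real_probability.
Context d (Omega : measurableType d) (R : realType) (P : probability Omega R).
Local Notation pr A := (fine (P A)).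
Implicit Types A B : set Omega.

Lemma prE A : measurable A -> (pr A)%:E = P A.
Proof. by move=> mA; rewrite fineK// fin_num_measure. Qed.

Lemma pr_ge0 A : 0 <= pr A.
Proof. exact: fine_ge0. Qed.

Lemma pr_le1 A : measurable A -> pr A <= 1.
Proof. by move=> mA; rewrite -lee_fin prE// probability_le1. Qed.

Lemma pr_le A B : measurable A -> measurable B -> A `<=` B -> pr A <= pr B.
Proof. by move=> mA mB AB; rewrite -lee_fin !prE// le_probS. Qed.

Lemma prU_le A B : measurable A -> measurable B -> pr (A `|` B) <= pr A + pr B.
Proof.
move=> mA mB; rewrite -lee_fin EFinD !prE//; last exact: measurableU.
exact: measureU2.
Qed.

Lemma pr_incl_excl A B : measurable A -> measurable B ->
  pr A + pr B = pr (A `|` B) + pr (A `&` B).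
Proof.
move=> mA mB; apply: EFin_inj; rewrite !EFinD !prE//; [|exact: measurableI|exact: measurableU].
rewrite measureUfinl//; last by rewrite -ge0_fin_numE// fin_num_measure.
by rewrite /= subeK// fin_num_measure//; exact: measurableI.
Qed.

Lemma pr_bigcup_le (m : nat) (A : nat -> set Omega) :
  (forall k, measurable (A k)) ->
  pr (\big[setU/set0]_(k < m) A k) <= \sum_(k < m) pr (A k).
Proof.
move=> mA; elim: m => [|m IHm]; first by rewrite !big_ord0 measure0.
rewrite !big_ord_recr/= (le_trans (prU_le _ _))// ?lerD2r//.
by apply: bigsetU_measurable.
Qed.

(** Inclusion-exclusion adds at most [m * e] for the new set, and [m + m^2 <= (m + 1)^2]. The crude
    count [m^2] suffices, as [m] is fixed while [e] tends to 0. *)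
Lemma bonferroni (m : nat) (A : nat -> set Omega) (e : R) :
  (forall k, measurable (A k)) ->
  (forall i j, (i < j)%N -> pr (A i `&` A j) <= e) ->
  \sum_(k < m) pr (A k) <= pr (\big[setU/set0]_(k < m) A k) + (m * m)%:R * e.
Proof.
move=> mA Ae; elim: m => [|m IHm]; first by rewrite !big_ord0 measure0 mul0r addr0.
have e0 : 0 <= e := le_trans (pr_ge0 _) (Ae 0%N 1%N isT).
rewrite !big_ord_recr/=; set U := \big[setU/set0]_(k < m) A k in IHm *.
have mU : measurable U by apply: bigsetU_measurable.
have UA : pr (U `&` A m) <= m%:R * e.
  have -> : U `&` A m = \big[setU/set0]_(k < m) (A k `&` A m).
    by rewrite /U big_distrl.
  rewrite (le_trans (pr_bigcup_le m (A := fun k => A k `&` A m) _))//.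
    by move=> k; exact: measurableI.
  rewrite (le_trans (ler_sum _ (_ : forall k, true -> _ <= e)))//.
    by move=> k _; exact: Ae.
  by rewrite sumr_const card_ord mulr_natl.
have := pr_incl_excl mU (mA m).
have : m%:R * e + (m * m)%:R * e <= (m.+1 * m.+1)%:R * e.
  by rewrite -mulrDl ler_wpM2r// -natrD ler_nat; lia.
lra.
Qed.

End real_probability.

(** * Pathwise comparison of ruin with large claims *)

Section ruin_event.
Context d (Omega : measurableType d) (R : realType) (P : probability Omega R).
Variables (lambda : R) (V : nat + nat -> Omega -> R).
Hypothesis lambda_gt0 : 0 < lambda.
Hypothesis mV : forall i, measurable_fun setT (V i).
Hypothesis indV : mutual_indep P V.
Hypothesis expV : forall k A, measurable A ->
  P (V (inl k) @^-1` A) = exponential_prob lambda A.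
Hypothesis idV : forall k A, measurable A ->
  P (V (inr k) @^-1` A) = P (V (inr 1%N) @^-1` A).
Hypothesis V_ge0 : forall k w, 0 <= V (inr k) w.
Variables (r T : R).
Hypotheses (r_gt0 : 0 < r) (T_gt0 : 0 < T).

Local Notation W := (fun k => V (inl k)).
Local Notation S := (fun k => V (inr k)).
Local Notation mth := (measurable_theta mV).
Local Notation pr A := (fine (P A)).
Local Notation g y := (pr [set w | y < V (inr 1%N) w]).
Local Notation J y := (fine (tail_average P V r T y)).
Local Notation big_claim := (big_claim V r T).

Definition discounted_sum n w := \sum_(1 <= k < n.+1) expR (- r * theta W k w) * S k w.

Definition ruin_event (p1 p2 x1 x2 : R) : set Omega :=
  [set w | exists t, 0 <= t <= T /\ exists n, Ncount W t w n /\
    Xproc r x1 p1 W S t w n < 0 /\ Xproc r x2 p2 W S t w n < 0].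

Lemma measurable_set_ltT (f : Omega -> R) (c : R) : measurable_fun setT f ->
  measurable [set w | c < f w].
Proof. by move=> mf; exact: measurable_lt_set (measurable_cst _) mf. Qed.

Lemma measurable_discounted_sum n : measurable_fun setT (discounted_sum n).
Proof.
apply: measurable_sum => k; apply: measurable_funM; last exact: mV.
by apply: measurableT_comp => //; apply: measurable_funM => //; exact: mth.
Qed.

(* Between two claims the reserves increase, so ruin can only begin at an
   arrival time [theta n] or at time 0. *)
Lemma measurable_ruin_event p1 p2 x1 x2 : 0 <= p1 -> 0 <= p2 ->
  measurable (ruin_event p1 p2 x1 x2).
Proof.
move=> p1_ge0 p2_ge0.
(* [tau n] is the earliest admissible time with count [n]; [theta] may be negative on a null event,
   while [t] starts at 0. *)
pose tau n w := Num.max 0 (theta W n w).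
have mtau n : measurable_fun setT (tau n) by apply: measurable_maxr => //; exact: mth.
pose X x p n w := x + p * (1 - expR (- r * tau n w)) - discounted_sum n w.
have mX x p n : measurable_fun setT (X x p n).
  apply: measurable_funB; last exact: measurable_discounted_sum.
  apply: measurable_funD => //; apply: measurable_funM => //.
  apply: measurable_funB => //; apply: measurableT_comp => //.
  exact: measurable_funM.
rewrite (_ : ruin_event _ _ _ _ = \bigcup_n ([set w | theta W n w <= tau n w] `&`
  [set w | tau n w < theta W n.+1 w] `&` [set w | tau n w <= T] `&`
  [set w | X x1 p1 n w < 0] `&` [set w | X x2 p2 n w < 0])).
  apply: bigcupT_measurable => n; repeat apply: measurableI.
  - exact: measurable_le_set (mth n) (mtau n).
  - exact: measurable_lt_set (mtau n) (mth n.+1).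
  - exact: measurable_le_set (mtau n) (measurable_cst _).
  - exact: measurable_lt_set (mX _ _ _) (measurable_cst _).
  - exact: measurable_lt_set (mX _ _ _) (measurable_cst _).
apply/seteqP; split => w.
  move=> [t [/andP[t0 tT] [n [/andP[nt tn] [X1 X2]]]]]; exists n => //.
  have taut : tau n w <= t by rewrite /tau ge_max t0.
  have XX x p : 0 <= p -> X x p n w <= Xproc r x p W S t w n.
    move=> p0; rewrite /X /Xproc lerD2r lerD2l ler_wpM2l// lerD2l lerN2 ler_expR.
    by rewrite !mulNr lerN2 ler_wpM2l// ltW.
  rewrite /=; repeat split.
  - by rewrite /tau le_max lexx orbT.
  - exact: le_lt_trans tn.
  - exact: le_trans tT.
  - exact: le_lt_trans (XX _ _ p1_ge0) X1.
  - exact: le_lt_trans (XX _ _ p2_ge0) X2.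
move=> [n _ [[[[/= ntau taun] tauT] X1] X2]]; exists (tau n w); split.
  by rewrite tauT andbT /tau le_max lexx.
by exists n; split; [rewrite /Ncount ntau|split].
Qed.

(** Off this null event arrival times are nonnegative and strictly increasing, so that discounting
    only shrinks claims. *)
Definition degenerate : set Omega := \bigcup_k [set w | V (inl k) w <= 0].

Lemma measurable_degenerate : measurable degenerate.
Proof.
by apply: bigcupT_measurable => k; exact: (measurable_interarrival_le0 mV).
Qed.

Lemma pr_degenerate : pr degenerate = 0.
Proof.
rewrite (_ : P degenerate = 0%E)//; apply: measure_negligible.
  exact: measurable_degenerate.
apply: negligible_bigcup => k; apply/negligibleP.
  exact: (measurable_interarrival_le0 mV).
exact: prob_interarrival_le0 expV k.
Qed.

Lemma theta_ge0 w k : ~ degenerate w -> 0 <= theta W k w.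
Proof.
move=> nd; apply: sumr_ge0 => i _; rewrite leNgt; apply/negP => /ltW Vi.
by apply: nd; exists i.
Qed.

Lemma discounted_term_le w k : ~ degenerate w ->
  expR (- r * theta W k w) * V (inr k) w <= V (inr k) w.
Proof.
move=> nd; rewrite ler_piMl// -expR0 ler_expR mulNr oppr_le0 mulr_ge0 ?theta_ge0//.
exact: ltW.
Qed.

Lemma theta_indep_claim n k y :
  P ([set w | theta W n w <= T] `&` [set w | y < V (inr k) w]) =
  (P [set w | (theta W n w <= T)%R] * P [set w | (y < V (inr 1%N) w)%R])%E.
Proof.
have := @theta_indep_cyl _ _ _ _ _ mV indV n [:: inr k]
  (fun=> `]y, +oo[%classic) `]-oo, T]%classic.
rewrite set_cons1 bigcap_set1 set_itvoy set_itvNyc -(tailE idV k); apply => //.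
- by move=> _; rewrite -set_itvoy.
- by rewrite -set_itvNyc.
Qed.

Lemma pr_two_large i j y : i != j ->
  pr ([set w | y < V (inr i) w] `&` [set w | y < V (inr j) w]) = g y ^+ 2.
Proof.
move=> ij; have uij : uniq [:: inr i; inr j : nat + nat].
  by rewrite /= andbT inE; apply: contraNneq ij => -[->].
have := indV (B := fun=> `]y, +oo[%classic) uij (fun=> measurable_itv _).
rewrite !big_cons big_nil mule1 set_seq_cons bigcap_setU1 set_cons1 bigcap_set1.
rewrite set_itvoy => ->.
have GE k : P (V (inr k) @^-1` [set x | y < x]) = P [set w | y < V (inr 1%N) w].
  exact: (tailE idV k).
have Gfin : P [set w | y < V (inr 1%N) w] \is a fin_num.
  by rewrite fin_num_measure//; exact: measurable_set_ltT.
by rewrite !GE fineM// expr2.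
Qed.

(** Dropping the discount factors enlarges the event, up to the null event, and leaves two
    independent claims. *)
Lemma pr_big_claim_pair i j y : (i < j)%N ->
  pr (big_claim i.+1 y `&` big_claim j.+1 y) <= g y ^+ 2.
Proof.
move=> ij; have ij' : i.+1 != j.+1 by rewrite eqSS ltn_eqF.
rewrite -(pr_two_large y ij'); set A := [set w | _] `&` _.
have mA : measurable A by apply: measurableI; exact: measurable_set_ltT.
have mb k := measurable_big_claim mV r T k y.
rewrite -[leRHS]addr0 -pr_degenerate (le_trans _ (prU_le P mA measurable_degenerate))//.
apply: pr_le.
- exact: measurableI.
- by apply: measurableU => //; exact: measurable_degenerate.
move=> w [[_ yi] [_ yj]]; have [|nd] := pselect (degenerate w); first by right.
by left; split => /=; [move: yi|move: yj] => /lt_le_trans; apply; exact: discounted_term_le.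
Qed.

(** At the arrival of a claim whose discounted size exceeds [x2 + p], both reserves are negative:
    the premium part is at most [p], [x1 <= x2], and the other claims only lower the reserves. *)
Lemma ruin_lower_bound m p1 p2 p x1 x2 : 0 <= p1 <= p -> 0 <= p2 <= p -> x1 <= x2 ->
  \sum_(k < m) pr (big_claim k.+1 (x2 + p)) <=
  pr (ruin_event p1 p2 x1 x2) + (m * m)%:R * g (x2 + p) ^+ 2.
Proof.
move=> /andP[p10 p1p] /andP[p20 p2p] x12.
have mb k : measurable (big_claim k.+1 (x2 + p)) := measurable_big_claim mV r T _ _.
have mE := measurable_ruin_event x1 x2 p10 p20.
rewrite (le_trans (@bonferroni _ _ _ P m (fun k => big_claim k.+1 (x2 + p)) _ mb
  (fun i j => @pr_big_claim_pair i j _)))// lerD2r.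
rewrite -[leRHS]addr0 -pr_degenerate (le_trans _ (prU_le P mE measurable_degenerate))//.
apply: pr_le.
- exact: bigsetU_measurable.
- by apply: measurableU => //; exact: measurable_degenerate.
move=> w; rewrite -(bigcup_mkord m (fun k => big_claim k.+1 (x2 + p))) => -[k /= km [thT yk]].
have [|nd] := pselect (degenerate w); [by right|left].
exists (theta W k.+1 w); split; first by rewrite thT andbT theta_ge0.
(* The count at this arrival is [k.+1] because the next waiting time is positive off
   [degenerate]. *)
exists k.+1; split.
  rewrite /Ncount lexx/= (thetaS V k.+1) ltrDl ltNge; apply/negP => Vk.
  by apply: nd; exists k.+1.
have Dk : expR (- r * theta W k.+1 w) * V (inr k.+1) w <= discounted_sum k.+1 w.
  rewrite /discounted_sum big_nat_recr//= lerDr sumr_ge0// => i _.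
  by rewrite mulr_ge0 ?expR_ge0.
have px p' : 0 <= p' -> p' * (1 - expR (- r * theta W k.+1 w)) <= p'.
  by move=> p'0; rewrite ler_piMr// gerBl expR_ge0.
have := px _ p10; have := px _ p20; rewrite /Xproc -/(discounted_sum k.+1 w).
split; lra.
Qed.

(** If [n] claims add up to more than [x], one of them exceeds [x / n]. Being undiscounted, it is
    independent of [theta W n]. *)
Definition late_large (n : nat) (x : R) : set Omega :=
  [set w | theta W n w <= T] `&`
  \big[setU/set0]_(j < n) [set w | x / n%:R < V (inr j.+1) w].

Lemma measurable_late_large n x : measurable (late_large n x).
Proof.
apply: measurableI; first exact: measurable_theta_le.
by apply: bigsetU_measurable => j _; exact: measurable_set_ltT.
Qed.

Lemma pr_late_large n x :
  pr (late_large n x) <= n%:R * (pr [set w | theta W n w <= T] * g (x / n%:R)).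
Proof.
rewrite /late_large big_distrr/=.
rewrite (le_trans (@pr_bigcup_le _ _ _ P n
  (fun j => [set w | theta W n w <= T] `&` [set w | x / n%:R < V (inr j.+1) w]) _))//.
  move=> k; apply: measurableI; first exact: measurable_theta_le.
  exact: measurable_set_ltT.
under eq_bigr => j _ do rewrite theta_indep_claim.
rewrite sumr_const card_ord mulr_natl fineM//.
  by rewrite fin_num_measure//; exact: measurable_theta_le.
by rewrite fin_num_measure//; exact: measurable_set_ltT.
Qed.

(** With an empty diagonal the bound [G z ^ 2] holds for all pairs, and unions can run over a full
    square of indices. *)
Definition two_large (z : R) (i j : nat) : set Omega :=
  if i == j then set0
  else [set w | z < V (inr i.+1) w] `&` [set w | z < V (inr j.+1) w].

Lemma measurable_two_large z i j : measurable (two_large z i j).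
Proof.
rewrite /two_large; case: eqP => // _.
by apply: measurableI; exact: measurable_set_ltT.
Qed.

Lemma pr_two_large_le z i j : pr (two_large z i j) <= g z ^+ 2.
Proof.
rewrite /two_large; have [_|ij] := eqVneq i j.
  by rewrite measure0 sqr_ge0.
by rewrite pr_two_large.
Qed.

(** [X_2 < 0] forces the discounted sum above [x2]. If the count [n] is at most [m],
    [two_large_or_one] applies; otherwise the path lies in [late_large n x2]. *)
Lemma ruin_cover m p1 p2 x1 x2 c delta : 0 <= p2 -> 0 < x2 ->
  0 <= c -> 0 <= delta -> c + m%:R * delta <= 1 ->
  ruin_event p1 p2 x1 x2 `<=`
  degenerate `|` \big[setU/set0]_(k < m) big_claim k.+1 (c * x2) `|`
  \big[setU/set0]_(i < m) \big[setU/set0]_(j < m) two_large (delta * x2) i j `|`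
  \bigcup_n late_large (m + n.+1) x2.
Proof.
move=> p20 x20 c0 d0 cm w [t [/andP[t0 tT] [n [/andP[nt tn] [_ X2]]]]].
have [nd|nd] := pselect (degenerate w); first by do 3 left.
have thn := le_trans nt tT.
have thmono k : (k <= n)%N -> theta W k w <= T.
  move=> kn; rewrite (le_trans _ thn)//.
  rewrite /theta -(subnKC kn) big_split_ord/= lerDl sumr_ge0// => i _.
  by rewrite leNgt; apply/negP => /ltW Vi; apply: nd; exists (k + i)%N.
have Dx : x2 < discounted_sum n w.
  move: X2; rewrite /Xproc -/(discounted_sum n w) subr_lt0; apply: le_lt_trans.
  rewrite lerDl mulr_ge0// subr_ge0 -expR0 ler_expR mulNr oppr_le0 mulr_ge0//.
  exact: ltW.
have [nm|mn] := leqP n m.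
  have := two_large_or_one nm (ltW x20) c0 d0 cm
    (fun k => @discounted_term_le w k nd) Dx.
  move=> [[k kn ck]|[i [j [ij jn si sj]]]].
    left; left; right; rewrite -(bigcup_mkord m (fun k => big_claim k.+1 (c * x2))).
    exists k => /=.
      exact: leq_trans nm.
    by split => //; exact: thmono.
  left; right.
  rewrite -(bigcup_mkord m (fun i => \big[setU/set0]_(j < m) two_large (delta * x2) i j)).
  have jm := leq_trans jn nm.
  have im := ltn_trans ij jm.
  exists i => //=; rewrite -(bigcup_mkord m (two_large (delta * x2) i)).
  exists j => //=.
  by rewrite /two_large ltn_eqF.
(* The last union starts at count [m + 1], hence the predecessor. *)
right; exists (n - m).-1 => //.
have -> : (m + (n - m).-1.+1)%N = n by rewrite prednK ?subn_gt0// subnKC// ltnW.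
split => //; rewrite -(bigcup_mkord n (fun j => [set w | x2 / n%:R < V (inr j.+1) w])).
apply: contrapT => nos.
have sk k : (k < n)%N -> V (inr k.+1) w <= x2 / n%:R.
  by move=> kn; rewrite leNgt; apply/negP => ?; apply: nos; exists k.
have n0 : (0 < n%:R :> R) by rewrite ltr0n (leq_ltn_trans _ mn).
move: Dx; apply/negP; rewrite -leNgt /discounted_sum big_add1/= big_mkord.
rewrite (le_trans (ler_sum _ (_ : forall k, true -> _ <= x2 / n%:R)))//.
  by move=> k _; rewrite (le_trans (discounted_term_le _ nd))// sk.
by rewrite sumr_const card_ord -[leLHS]mulr_natl mulrC mulfVK// gt_eqF.
Qed.

End ruin_event.

Lemma natr_le_pow2 {R : realType} (n : nat) : n%:R <= 2 ^+ n :> R.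
Proof. by rewrite -(natrX R 2 n) ler_nat ltnW// ltn_expl. Qed.

Lemma exists_pow2_ge {R : realType} (a : R) : exists n : nat, a <= 2 ^+ n.
Proof.
exists (Num.bound `|a|); apply: le_trans (natr_le_pow2 _).
by rewrite (le_trans (ler_norm _))// ltW// archi_boundP.
Qed.

(** * Remainder estimates and the limit *)

Section ruin_asymptotics.
Context d (Omega : measurableType d) (R : realType) (P : probability Omega R).
Variables (lambda : R) (V : nat + nat -> Omega -> R).
Hypothesis lambda_gt0 : 0 < lambda.
Hypothesis mV : forall i, measurable_fun setT (V i).
Hypothesis indV : mutual_indep P V.
Hypothesis expV : forall k A, measurable A ->
  P (V (inl k) @^-1` A) = exponential_prob lambda A.
Hypothesis idV : forall k A, measurable A ->
  P (V (inr k) @^-1` A) = P (V (inr 1%N) @^-1` A).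
Hypothesis V_ge0 : forall k w, 0 <= V (inr k) w.
Variables (r T : R).
Hypotheses (r_gt0 : 0 < r) (T_gt0 : 0 < T).

Local Notation W := (fun k => V (inl k)).
Local Notation pr A := (fine (P A)).
Local Notation g y := (pr [set w | y < V (inr 1%N) w]).
Local Notation J y := (fine (tail_average P V r T y)).
Local Notation big_claim := (big_claim V r T).
Local Notation ruin_event := (ruin_event V r T).
Local Notation late_large := (late_large V T).

Variable K : R.
Hypothesis K_ge1 : 1 <= K.
Hypothesis g_halving : forall x, 0 < x -> g (x / 2) <= K * g x.

Let g_ninc x y : x <= y -> g y <= g x.
Proof.
move=> xy; apply: pr_le; [exact: measurable_set_ltT..|].
by move=> w /=; exact: le_lt_trans.
Qed.

Let K_ge0 : 0 <= K := le_trans ler01 K_ge1.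

(** The free rate is set to [4 * K * lambda]. In the ratio [1 / (4 * K)], the [K] cancels [K ^ n]
    from the halvings, one factor 2 absorbs the [n <= 2 ^ n] terms of the union bound, and the other
    leaves a summable [2 ^ - n]. *)
Lemma pr_theta_le n :
  pr [set w | theta W n w <= T] <= (4 * K)^-1 ^+ n * expR (4 * K * lambda * T).
Proof.
have K0 : 0 < K := lt_le_trans ltr01 K_ge1.
have s0 : 0 < 4 * K * lambda by rewrite !mulr_gt0.
rewrite -lee_fin prE; last exact: measurable_theta_le.
rewrite (le_trans (theta_le_expR lambda_gt0 mV indV expV n s0 (ltW T_gt0)))// lee_fin.
by rewrite [4 * K * lambda]mulrC invfM mulVKf ?gt_eqF.
Qed.

Lemma pr_late_large_le n x : 0 < x ->
  pr (late_large n x) <= expR (4 * K * lambda * T) * g x / 2 ^+ n.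
Proof.
move=> x0; rewrite (le_trans (pr_late_large mV indV idV T n x))//.
have K0 : 0 < K := lt_le_trans ltr01 K_ge1.
case: n => [|n]; first by rewrite mul0r expr0 divr1 mulr_ge0 ?expR_ge0 ?pr_ge0.
set N := n.+1.
have N2 := @natr_le_pow2 R N.
(* Since [N <= 2 ^ N], the level [x / N] lies above [x] halved [N] times. *)
have gN : g (x / N%:R) <= K ^+ N * g x.
  apply: le_trans (halving_iter K_ge0 g_halving N x0).
  by apply: g_ninc; rewrite ler_wpM2l ?(ltW x0)// lef_pV2 ?posrE ?exprn_gt0 ?ltr0n.
have step : pr [set w | theta W N w <= T] * g (x / N%:R) <=
    (4 * K)^-1 ^+ N * expR (4 * K * lambda * T) * (K ^+ N * g x).
  by apply: ler_pM => //; [exact: pr_ge0..|exact: pr_theta_le].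
rewrite (le_trans (ler_pM _ _ N2 step))// ?mulr_ge0 ?pr_ge0//.
rewrite le_eqVlt; apply/orP; left; apply/eqP.
rewrite exprVn exprMn.
have -> : 4 ^+ N = 2 ^+ N * 2 ^+ N :> R by rewrite -exprMn -natrM.
have ? : 2 ^+ N != 0 :> R by rewrite gt_eqF ?exprn_gt0.
have ? : K ^+ N != 0 by rewrite gt_eqF ?exprn_gt0.
by field; apply/andP; split.
Qed.

Lemma pr_bigcup_late_large m x : 0 < x ->
  pr (\bigcup_n late_large (m + n.+1) x) <=
  expR (4 * K * lambda * T) * g x / 2 ^+ m.
Proof.
move=> x0; set a := _ / _.
have mL n : measurable (late_large n x) by exact: measurable_late_large.
have mU : measurable (\bigcup_n late_large (m + n.+1) x) by exact: bigcupT_measurable.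
rewrite -lee_fin prE// (le_trans (generalized_Boole_inequality P _ mU))//.
have a0 : 0 <= a by rewrite divr_ge0 ?mulr_ge0 ?expR_ge0 ?exprn_ge0 ?pr_ge0.
(* As the counts are [m + n.+1], the terms are at most [a / 2 ^ n.+1], a series with sum [a]. *)
apply: le_trans (epsilon_trick0 xpredT a0).
apply: lee_nneseries => // n _.
rewrite -[leLHS]prE// lee_fin (le_trans (pr_late_large_le _ x0))//.
by rewrite /a natrX exprD invfM mulrA.
Qed.

Lemma ruin_upper_bound m p1 p2 x1 x2 c delta : 0 <= p1 -> 0 <= p2 -> 0 < x2 ->
  0 <= c -> 0 <= delta -> c + m%:R * delta <= 1 ->
  pr (ruin_event p1 p2 x1 x2) <= \sum_(k < m) pr (big_claim k.+1 (c * x2)) +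
    (m * m)%:R * g (delta * x2) ^+ 2 + expR (4 * K * lambda * T) * g x2 / 2 ^+ m.
Proof.
move=> p10 p20 x20 c0 d0 cm.
have mb k : measurable (big_claim k.+1 (c * x2)) := measurable_big_claim mV r T _ _.
have mtl i j : measurable (two_large V (delta * x2) i j) by exact: measurable_two_large.
have mD : measurable (degenerate V) by exact: measurable_degenerate.
have mB : measurable (\big[setU/set0]_(k < m) big_claim k.+1 (c * x2)).
  exact: bigsetU_measurable.
have mTi i : measurable (\big[setU/set0]_(j < m) two_large V (delta * x2) i j).
  exact: bigsetU_measurable.
have mT' : measurable (\big[setU/set0]_(i < m) \big[setU/set0]_(j < m)
    two_large V (delta * x2) i j) by exact: bigsetU_measurable.
have mL : measurable (\bigcup_n late_large (m + n.+1) x2).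
  by apply: bigcupT_measurable => n; exact: measurable_late_large.
have mE : measurable (ruin_event p1 p2 x1 x2) by exact: measurable_ruin_event.
apply: le_trans (pr_le P mE _ (ruin_cover V_ge0 r_gt0 p20 x20 c0 d0 cm)) _.
  by do 3 (apply: measurableU => //).
rewrite (le_trans (prU_le P _ mL))//; first by do 2 (apply: measurableU => //).
apply: lerD; last exact: pr_bigcup_late_large.
rewrite (le_trans (prU_le P _ mT'))//; first exact: measurableU.
apply: lerD.
  rewrite (le_trans (prU_le P mD mB))// (pr_degenerate mV expV) add0r.
  exact: (pr_bigcup_le P m mb).
rewrite (le_trans (pr_bigcup_le P m mTi))//.
have inner i : pr (\big[setU/set0]_(j < m) two_large V (delta * x2) i j) <=
    m%:R * g (delta * x2) ^+ 2.
  rewrite (le_trans (pr_bigcup_le P m (mtl i)))//.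
  rewrite (le_trans (ler_sum _ (_ : forall k, true -> _ <= g (delta * x2) ^+ 2)))//.
    by move=> k _; exact: pr_two_large_le.
  by rewrite sumr_const card_ord mulr_natl.
rewrite (le_trans (ler_sum _ (fun (i : 'I_m) _ => inner i)))//.
by rewrite sumr_const card_ord -[leLHS]mulr_natl mulrA natrM.
Qed.

Hypothesis g_gt0 : forall x, 0 < x -> 0 < g x.
Hypothesis g_cvg0 : forall e, 0 < e -> exists2 x0, 0 < x0 & g x0 <= e.
Hypothesis g_near1 : forall eta, 0 < eta ->
  exists c, [/\ 0 < c, c < 1 & exists2 x0 : R, 0 < x0 &
    forall x, x0 <= x -> g (c * x) <= (1 + eta) * g x].

Let gE x : (g x)%:E = P [set w | x < V (inr 1%N) w].
Proof. by apply: prE; exact: measurable_set_ltT. Qed.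

Let JE x : (J x)%:E = tail_average P V r T x.
Proof. by rewrite fineK//; exact: tail_average_fin. Qed.

Let sum_prE m y : (\sum_(k < m) pr (big_claim k.+1 y))%:E =
  (\sum_(k < m) P (big_claim k.+1 y))%E.
Proof.
rewrite -sumEFin; apply: eq_bigr => k _; apply: prE.
exact: measurable_big_claim.
Qed.

(** [J x] is at least [T * g (x * e^(r T))], and [N] halvings with [2 ^ N >= e^(r T)] lead back to
    [g x] at the cost [K ^ N]. *)
Lemma tail_le_average : exists2 C, 0 < C & forall x, 0 < x -> g x <= C * J x.
Proof.
have [N HN] := exists_pow2_ge (expR (r * T)).
have K0 : 0 < K := lt_le_trans ltr01 K_ge1.
exists (K ^+ N / T) => [|x x0]; first by rewrite divr_gt0// exprn_gt0.
have tJ : T * g (x * expR (r * T)) <= J x.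
  by rewrite -lee_fin EFinM gE JE; apply: tail_average_ge => //; exact: ltW.
rewrite -mulrA (@le_trans _ _ (K ^+ N * g (x * expR (r * T))))//; last first.
  by rewrite ler_wpM2l ?exprn_ge0// ler_pdivlMl.
have x20 : 0 < x * 2 ^+ N by rewrite mulr_gt0// exprn_gt0.
have := halving_iter K_ge0 g_halving N x20.
rewrite mulfK ?gt_eqF ?exprn_gt0// => /le_trans; apply.
by rewrite ler_wpM2l ?exprn_ge0// g_ninc// ler_wpM2l// ltW.
Qed.

Lemma ruin_probability_asymptotics p1 p2 : 0 <= p1 -> 0 <= p2 ->
  forall eps, 0 < eps -> exists M : R, forall x1 x2, M <= x1 -> x1 <= x2 ->
    `| pr (ruin_event p1 p2 x1 x2) / (lambda * J x2) - 1 | < eps.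
Proof.
move=> p10 p20 eps eps0.
(* Either bound below loses [3 * e], which is less than [4 * e <= eps]; [e <= 1 / 4] keeps [1 - e]
   positive. *)
pose e := Num.min (eps / 4) (1 / 4).
have e0 : 0 < e by rewrite lt_min !divr_gt0.
have e4 : 4 * e <= eps by rewrite -ler_pdivlMl// mulrC ge_min lexx.
have [C C0 gC] := tail_le_average.
have [c [c0 c1 [xc xc0 Hc]]] := g_near1 e0.
set E := expR (4 * K * lambda * T).
have E0 : 0 < E := expR_gt0 _.
(* One choice of [m] serves two purposes: [1] yields [E / 2 ^ m <= e] for the lower bound, and
   [C / lambda] makes the late arrivals cost at most [e * lambda * J x2]. Taking [m = N.+1] keeps it
   positive for the division in [delta]. *)
have [N HN] := exists_pow2_ge (E * (C / lambda + 1) / e).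
pose m := N.+1.
have pm0 : 0 < 2 ^+ m :> R by rewrite exprn_gt0.
have Cl0 : 0 < C / lambda by rewrite divr_gt0.
have Em : E / 2 ^+ m * (C / lambda + 1) <= e.
  move: HN; rewrite ler_pdivrMr// mulrAC ler_pdivrMr// => /le_trans; apply.
  rewrite [leRHS]mulrC ler_wpM2r ?(ltW e0)// /m exprS ler_peMl ?exprn_ge0//; lra.
have Em0 : 0 < E / 2 ^+ m by rewrite divr_gt0.
have Em1 : E / 2 ^+ m <= e by nra.
have EmC : E / 2 ^+ m * C <= e * lambda.
  rewrite -ler_pdivrMr// -mulrA; nra.
(* The [m] small claims then fill exactly the share [1 - c] left by the big one. *)
pose delta := (1 - c) / m%:R.
have m0 : 0 < m%:R :> R by rewrite ltr0n.
have d0 : 0 < delta by rewrite divr_gt0// subr_gt0.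
have cm : c + m%:R * delta <= 1 by rewrite /delta mulrC divfK ?gt_eqF// subrKC.
have [n Hn] := exists_pow2_ge delta^-1.
(* The two-claim term is at most [D * g x2 * J x2], since [2 ^ n >= 1 / delta] and [g <= C * J].
   Requiring [g <= e * lambda / (D + 1)] brings it below [e * lambda * J x2]. *)
pose D := (m * m)%:R * K ^+ n ^+ 2 * C.
have D0 : 0 <= D by rewrite !mulr_ge0 ?exprn_ge0// ltW.
have [xg xg0 Hg] := g_cvg0 (divr_gt0 (mulr_gt0 e0 lambda_gt0) (ltr_wpDl D0 ltr01)).
pose p := Num.max p1 p2.
(* The last threshold amounts to [c * (x2 + p) <= x2], so the premium is absorbed by the scaling
   [c]. *)
exists (Num.max xc (Num.max xg (p * c / (1 - c)))) => x1 x2.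
rewrite !ge_max => /andP[xc1 /andP[xg1 xp1]] x12.
have xc2 := le_trans xc1 x12; have xg2 := le_trans xg1 x12.
have xp2 := le_trans xp1 x12.
have x20 : 0 < x2 := lt_le_trans xc0 xc2.
have gx0 := g_gt0 x20; have gCx := gC _ x20.
have Jx0 : 0 < J x2 by rewrite -(pmulr_rgt0 _ C0); exact: lt_le_trans gCx.
set psi := pr (ruin_event _ _ _ _); set a := lambda * J x2.
have a0 : 0 < a by rewrite mulr_gt0.
have Kn1 : 1 <= K ^+ n by rewrite exprn_ege1.
have gD : (m * m)%:R * (K ^+ n * g x2) ^+ 2 <= e * a.
  have -> : (m * m)%:R * (K ^+ n * g x2) ^+ 2 =
      (m * m)%:R * K ^+ n ^+ 2 * (g x2 * g x2) by rewrite exprMn mulrA -expr2.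
  have gg : g x2 * g x2 <= C * (g x2 * J x2).
    by rewrite [leRHS]mulrCA ler_wpM2l ?(ltW gx0).
  apply: (@le_trans _ _ (D * (g x2 * J x2))).
    rewrite /D -[leRHS]mulrA ler_wpM2l//.
    by rewrite mulr_ge0 ?exprn_ge0.
  rewrite mulrA mulrA ler_wpM2r ?ltW//.
  have gxg : g x2 <= e * lambda / (D + 1) := le_trans (g_ninc xg2) Hg.
  rewrite ler_pdivlMr ?ltr_wpDl// in gxg; nra.
have gd : g (delta * x2) <= K ^+ n * g x2.
  apply: le_trans (halving_iter K_ge0 g_halving n x20).
  apply: g_ninc; rewrite [leRHS]mulrC ler_wpM2l ?(ltW x20)//.
  by rewrite invf_ple ?posrE ?exprn_gt0.
have up : psi <= a * (1 + 3 * e).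
  apply: (le_trans (@ruin_upper_bound m p1 p2 x1 x2 c delta p10 p20 x20 (ltW c0)
    (ltW d0) _)); first by rewrite cm.
  have S1 : \sum_(k < m) pr (big_claim k.+1 (c * x2)) <= lambda * J (c * x2).
    rewrite -lee_fin sum_prE EFinM JE; exact: sum_big_claim_le.
  have S2 : J (c * x2) <= (1 + e) * J x2.
    rewrite -lee_fin EFinM !JE; apply: (tail_average_scale mV T r_gt0 _ xc0 _ xc2).
      by rewrite addr_ge0// ltW.
    by move=> x xcx; rewrite -(gE (c * x)) -(gE x) -EFinM lee_fin Hc.
  have S3 : (m * m)%:R * g (delta * x2) ^+ 2 <= e * a.
    apply: le_trans gD; rewrite ler_wpM2l// ler_pXn2r ?nnegrE ?pr_ge0//.
    by rewrite mulr_ge0 ?exprn_ge0 ?pr_ge0.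
  have S4 : E * g x2 / 2 ^+ m <= e * a.
    rewrite mulrAC (@le_trans _ _ (E / 2 ^+ m * (C * J x2)))//.
      by rewrite ler_wpM2l// ltW.
    by rewrite mulrA /a mulrA ler_wpM2r// ltW.
  have S5 : lambda * J (c * x2) <= lambda * ((1 + e) * J x2).
    by rewrite ler_wpM2l// ltW.
  rewrite -/E /a in S3 S4 *; lra.
have lo : a * (1 - 3 * e) <= psi.
  have p1p : 0 <= p1 <= p by rewrite p10 le_max lexx.
  have p2p : 0 <= p2 <= p by rewrite p20 le_max lexx orbT.
  have p0 : 0 <= p by case/andP: p1p => /le_trans; apply.
  have low := @ruin_lower_bound _ _ _ P lambda V mV indV expV idV V_ge0 r T r_gt0 m
    p1 p2 p x1 x2 p1p p2p x12.
  have S1 : lambda * (1 - pr [set w | theta W m w <= T]) * J (x2 + p) <=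
      \sum_(k < m) pr (big_claim k.+1 (x2 + p)).
    rewrite -lee_fin sum_prE EFinM JE; exact: sum_big_claim_ge.
  have F1 : pr [set w | theta W m w <= T] <= e.
    apply: (le_trans (pr_theta_le m)); apply: le_trans Em1; rewrite -/E mulrC.
    rewrite ler_wpM2l ?(ltW E0)// exprVn lef_pV2 ?posrE ?exprn_gt0 ?mulr_gt0//;
      last exact: lt_le_trans K_ge1.
    by rewrite lerXn2r ?nnegrE ?mulr_ge0//; move: K_ge1; lra.
  (* Writing [x2 = c * (x2 / c)] gives [(1 + e) * J (x2 / c)], and [x2 + p <= x2 / c]. *)
  have S2 : J x2 <= (1 + e) * J (x2 + p).
    have xc' : xc <= x2 / c by rewrite ler_pdivlMr// (le_trans _ xc2)// ler_piMr ?ltW.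
    rewrite -lee_fin EFinM !JE.
    have -> : x2 = c * (x2 / c) by rewrite mulrC divfK// gt_eqF.
    rewrite (le_trans (tail_average_scale (b := 1 + e) mV T r_gt0 _ xc0 _ xc'))//.
    + by rewrite addr_ge0// ltW.
    + by move=> x xcx; rewrite -(gE (c * x)) -(gE x) -EFinM lee_fin Hc.
    rewrite lee_wpmul2l ?lee_fin ?addr_ge0 ?(ltW e0)//.
    apply: tail_average_ninc => //; rewrite mulrC divfK ?gt_eqF//.
    rewrite ler_pdivlMr// mulrDl -lerBrDl.
    by move: xp2; rewrite ler_pdivrMr ?subr_gt0// mulrBr mulr1.
  have S3 : (m * m)%:R * g (x2 + p) ^+ 2 <= e * a.
    apply: le_trans gD; rewrite ler_wpM2l// ler_pXn2r ?nnegrE ?pr_ge0//; last first.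
      by rewrite mulr_ge0 ?exprn_ge0 ?pr_ge0.
    apply: (@le_trans _ _ (g x2)); first by rewrite g_ninc// lerDl.
    by rewrite ler_peMl ?pr_ge0.
  set F := pr _ in S1 F1; set Jp := J (x2 + p) in S1 S2.
  have S4 : lambda * (1 - e) * Jp <= psi + e * a.
    apply: le_trans (le_trans S1 (le_trans low _)).
      rewrite ler_wpM2r ?ler_wpM2l ?lerD2l ?lerN2 ?(ltW lambda_gt0)//.
      by rewrite /Jp fine_ge0// integral_ge0.
    by rewrite lerD2l.
  have e14 : e <= 1 / 4 by rewrite ge_min lexx orbT.
  have S5 : (1 - e) * a <= (1 + e) * (psi + e * a).
    apply: (@le_trans _ _ ((1 + e) * (lambda * (1 - e) * Jp))).
      rewrite [leRHS](_ : _ = (1 - e) * (lambda * ((1 + e) * Jp))); last by ring.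
      rewrite ler_wpM2l//; first by lra.
      by rewrite ler_wpM2l// ltW.
    by rewrite ler_wpM2l//; lra.
  (* Otherwise [(1 - e) * a < (1 + e) * (1 - 2 * e) * a], whereas the left side is larger by
     [2 * e ^ 2 * a]. *)
  rewrite leNgt; apply/negP => psilt.
  have : (1 + e) * (psi + e * a) < (1 + e) * (a * (1 - 3 * e) + e * a).
    by rewrite ltr_pM2l ?ltrD2r//; lra.
  move=> /(le_lt_trans S5); apply/negP; rewrite -leNgt.
  rewrite -subr_ge0 [leRHS](_ : _ = a * (2 * e ^+ 2)); last by ring.
  by rewrite mulr_ge0 ?ltW// mulr_gt0// exprn_gt0.
rewrite ltr_norml ltrBrDr ltrBlDr ltr_pdivlMr// ltr_pdivrMr//.
apply/andP; split; nra.
Qed.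

End ruin_asymptotics.

Theorem theorem3p1 (R : realType) (d : measure_display)
  (Omega : measurableType d) (P : probability Omega R)
  (r lambda c1 c2 delta1 delta2 alpha T : R) (L : R -> R)
  (W S : nat -> {RV P >-> R}) :
  0 < r -> 0 < lambda -> 0 < c1 -> 0 < c2 ->
  0 < delta1 < 1 -> 0 < delta2 < 1 -> delta1 + delta2 = 1 ->
  c1 / delta1 > c2 / delta2 ->
  (* W_0, W_1, ... (inter-arrival times) and sigma_0, sigma_1, ... (claims)
     are mutually independent *)
  mutual_indep P (fun i : nat + nat =>
    match i with inl k => (W k : Omega -> R) | inr k => (S k : Omega -> R) end) ->
  (* inter-arrival times are Exp(lambda): N is a Poisson process *)
  (forall k A, measurable A ->
     P ((W k : Omega -> R) @^-1` A) = exponential_prob lambda A) ->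
  (* claims are identically distributed and nonnegative *)
  (forall k A, measurable A ->
     P ((S k : Omega -> R) @^-1` A) = P ((S 1 : Omega -> R) @^-1` A)) ->
  (forall k w, 0 <= S k w) ->
  (* regularly varying tail with slowly varying L -> oo *)
  0 < alpha ->
  {in `]0, +oo[, continuous L} ->
  slowly_varying L ->
  L x @[x --> +oo] --> +oo ->
  (forall x, 0 < x ->
     P [set w | (S 1 : Omega -> R) w > x] = (L x / x `^ alpha)%:E) ->
  0 < T ->
  forall eps, 0 < eps -> exists M : R, forall x1 x2, M <= x1 -> x1 <= x2 ->
    `| Psi_max P r (c1 / (r * delta1)) (c2 / (r * delta2))
         (fun k => (W k : Omega -> R)) (fun k => (S k : Omega -> R)) x1 x2 T
       / (lambda * T * F_T_bar P r T (S 1 : Omega -> R) x2) - 1 | < eps.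
Proof.
move=> r0 lam0 c10 c20 /andP[d10 _] /andP[d20 _] _ _ ind expW idS S0 al0 _ Lsv _ GL T0.
pose V (i : nat + nat) : Omega -> R :=
  match i with inl k => (W k : Omega -> R) | inr k => (S k : Omega -> R) end.
have mV i : measurable_fun setT (V i) by case: i => k; exact: measurable_funPT.
pose g y := fine (P [set w | y < V (inr 1%N) w]).
have gE x : 0 < x -> g x = L x / x `^ alpha by move=> x0; rewrite /g GL.
have mS y : measurable [set w | y < V (inr 1%N) w] by exact: measurable_set_ltT.
have g_ninc x y : x <= y -> g y <= g x.
  by move=> xy; apply: pr_le => // w /=; exact: le_lt_trans.
have g_le1 x : g x <= 1 by apply: pr_le1.
have [K K1 HK] := tail_halving Lsv gE g_ninc g_le1.
have g_cvg0 e : 0 < e -> exists2 x0, 0 < x0 & g x0 <= e.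
  move=> e0; have /fine_cvgP[_] := cvg_ccdfy0 (S 1%N).
  move=> /cvgrPdist_le/(_ e e0)[A [_ HA]].
  exists (Num.max A 0 + 1); first by rewrite ltr_wpDl// le_max lexx orbT.
  have /HA : A < Num.max A 0 + 1 by rewrite ltr_pwDr// le_max lexx.
  rewrite /= sub0r normrN => /(le_trans (ler_norm _)).
  by rewrite /ccdf /distribution /pushforward set_itvoy.
have H := @ruin_probability_asymptotics _ _ _ P lambda V lam0 mV ind expW idS S0 r T
  r0 T0 K K1 HK (tail_gt0 Lsv gE) g_cvg0
  (fun eta eta0 => tail_scale_near1 al0 Lsv gE eta0).
have p10 : 0 <= c1 / (r * delta1) by rewrite divr_ge0 ?mulr_ge0// ltW.
have p20 : 0 <= c2 / (r * delta2) by rewrite divr_ge0 ?mulr_ge0// ltW.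
move=> eps eps0; have [M HM] := H _ _ p10 p20 _ eps0.
exists M => x1 x2 Mx1 x12; have := HM _ _ Mx1 x12.
(* The denominator [lambda * J x2] turns into the one with [F_T_bar]. *)
by rewrite -(F_T_barE P mV r T0) mulrA.
Qed.
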